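(* Let $Q(z)$ be a complex cubic polynomial with three distinct roots $a_1,a_2,a_3$, and for $i\in\{1,2,3\}$ let $\mathcal C_{Q_i}(z)=\int\frac{dM_i(\xi)}{z-\xi}$ be the Cauchy transform of the measure $M_i$. Then for each $i$, outside the ellipse $E_i$ (i.e. on the complement of the closed elliptic domain $\tilde E_i$), $\mathcal C_{Q_i}$ satisfies the linear non-homogeneous differential equation $$Q(z)\mathcal C''_{Q_i}(z)+Q'(z)\mathcal C'_{Q_i}(z)+\frac{Q''(z)}{8}\mathcal C_{Q_i}(z)+\frac{Q'''(z)}{24}=0 .$$
   Context: For $i\in\{1,2,3\}$ let $j,k$ be the other two indices. $E_i$ is the ellipse with foci $a_j,a_k$ passing through $a_i$, and $\tilde E_i$ the closed elliptic domain it bounds. Write $Q(z)=c\big((z-a_i)^3+v_i(z-a_i)^2+w_i(z-a_i)\big)$ with $c\neq0$. For distinct $\alpha_1,\alpha_2\in\mathbb C$, the arcsine measure $\omega_{[\alpha_1,\alpha_2]}$ is the probability measure supported on the segment $[\alpha_1,\alpha_2]$ with density $\frac{1}{\pi\sqrt{|(t-\alpha_1)(t-\alpha_2)|}}$ with respect to arclength. With $\xi(\theta)=a_i-v_i\theta^2$ and $\psi(\theta)=-w_i(1-\theta^2)\theta^2$, $M_i=\int_0^1\omega_{[\xi(\theta)-2\sqrt{\psi(\theta)},\,\xi(\theta)+2\sqrt{\psi(\theta)}]}\,d\theta$. *)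

(* Defs.v *)
From HB Require Import structures.
From mathcomp Require Import all_boot all_order all_algebra.
From mathcomp Require Import all_classical all_reals all_analysis.
From mathcomp Require Import complex.
Import numFieldNormedType.Exports.

Set Implicit Arguments.
Unset Strict Implicit.
Unset Printing Implicit Defensive.

Import Order.TTheory GRing.Theory Num.Theory.
Local Open Scope ring_scope.
Local Open Scope classical_set_scope.

Section Defs.
Variable R : realType.
Local Notation C := R[i].

Definition Cintegral (D : set R) (f : R -> C) : C :=
  ((Rintegral lebesgue_measure D (fun x => complex.Re (f x)))
   +i* (Rintegral lebesgue_measure D (fun x => complex.Im (f x))))%C.

(* Integral of f against the arcsine measure omega_[a1,a2]: the segment
   [a1,a2] is parametrized by xi(s) = a1 + s (a2 - a1), s in [0,1], whose
   arclength element is |a2 - a1| ds; the density w.r.t. arclength is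
   1 / (pi sqrt |(xi - a1)(xi - a2)|). *)
Definition arcsine_integral (a1 a2 : C) (f : C -> C) : C :=
  Cintegral `[0, 1]
    (fun s : R =>
       let xi := a1 + (s%:C)%C * (a2 - a1) in
       f xi * ((Normc.normc (a2 - a1) /
                (pi * Num.sqrt (Normc.normc ((xi - a1) * (xi - a2)))))%:C)%C).

(* Integral of f against the measure
   M = \int_0^1 omega_[xi(th) - 2 sqrt(psi th), xi(th) + 2 sqrt(psi th)] dth,
   with xi(th) = a - v th^2 and psi(th) = - w (1 - th^2) th^2. *)
Definition M_integral (a v w : C) (f : C -> C) : C :=
  Cintegral `[0, 1]
    (fun th : R =>
       let t := (th%:C)%C in
       let xi := a - v * t ^+ 2 in
       let psi := - w * (1 - t ^+ 2) * t ^+ 2 in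
       arcsine_integral (xi - 2 * sqrtc psi) (xi + 2 * sqrtc psi) f).

Definition cauchy_M (a v w : C) (z : C) : C :=
  M_integral a v w (fun xi => (z - xi)^-1).

Definition closed_ellipse_dom (f1 f2 p : C) : set C :=
  [set z | Normc.normc (z - f1) + Normc.normc (z - f2)
           <= Normc.normc (p - f1) + Normc.normc (p - f2)].

End Defs.

(* Main.v *)
(** Let S be a complex symmetric 3x3 matrix with eigenvalues 0, a_j - a_i,
    a_k - a_i. In latitude-longitude coordinates (with theta = sin t), M_i is
    the law of a_i + <S n, n> for a uniform point n of the unit sphere; the
    arcsine law comes from the longitude. If f(x) = 1/(z - x), then Taylor
    expansion of Q at x turns the differential expression into
    Q f'' + Q' f' + Q'' f / 8, and by Cayley-Hamilton this function of
    x = a_i + <S n, n> is the divergence of a tangent field on the sphere, so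
    its mean vanishes (by symmetry a quarter of the sphere suffices, and the
    net flux through its boundary is zero). The point a_i + <S n, n> always
    lies on a segment with endpoints on the ellipse E_i, so z may be any point
    outside. *)

Require Import Defs.
From HB Require Import structures.
From mathcomp Require Import all_boot all_order all_algebra.
From mathcomp Require Import all_classical all_reals all_analysis.
From mathcomp Require Import measurable_realfun complex ring lra.
Import numFieldNormedType.Exports.
Import Order.TTheory GRing.Theory Num.Theory.
Local Open Scope ring_scope.
Local Open Scope classical_set_scope.

Set Implicit Arguments.
Unset Strict Implicit.
Unset Printing Implicit Defensive.

(** Two obstacles shape the proof. The arcsine density is unbounded at the ends of each segment, and
    the segments shrink to points at theta = 0 and theta = 1. Two angles, theta = sin t and a
    position proportional to - cos x along the segment, absorb both: the weight becomes
    [cos t / pi], and away from the ellipse all integrands are bounded and continuous for all real t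
    and x. The other obstacle is that z is complex while the integrals are handled by real analysis.
    Derivatives in z are therefore read off from exact expansions of the powers of 1/(z + h - x) in
    h, whose quadratic remainder is bounded uniformly because z has positive distance to the
    parametrized points. The matrix S enters only through k with k^2 = - w and through its trace -
    v. The inhomogeneous term is what survives of Q''' in the Taylor expansion: the powers of z - x
    cancel there, leaving a constant times the total mass 1. *)

(** * Calculus of complex-valued functions of a real variable *)

Section ComplexCalculus.
Variable R : realType.
Local Notation C := R[i].
Implicit Types (f g : R -> C) (z : C).

Lemma normcE (z : C) : `|z| = ((Normc.normc z)%:C)%C.
Proof. by []. Qed.

Lemma normc_ge0 (z : C) : 0 <= Normc.normc z.
Proof. by case: z => x y /=; rewrite sqrtr_ge0. Qed.

Lemma normcX (z : C) n : Normc.normc (z ^+ n) = Normc.normc z ^+ n.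
Proof.
elim: n => [|n IH]; first by rewrite !expr0 Normc.normc1.
by rewrite !exprS Normc.normcM IH.
Qed.

Lemma normc_real (x : R) : Normc.normc (x%:C)%C = `|x|.
Proof. by rewrite /= expr0n addr0 sqrtr_sqr. Qed.

Lemma Re_le_normc (z : C) : `|complex.Re z| <= Normc.normc z.
Proof. by rewrite -lecR -normcE normc_ge_Re. Qed.

Lemma Im_le_normc (z : C) : `|complex.Im z| <= Normc.normc z.
Proof.
case: z => x y /=; rewrite -(sqrtr_sqr y) ler_sqrt ?lerDr ?sqr_ge0//.
by rewrite addr_ge0 ?sqr_ge0.
Qed.

Lemma normc_le_ReIm (z : C) :
  Normc.normc z <= `|complex.Re z| + `|complex.Im z|.
Proof.
case: z => x y /=; rewrite -[leRHS]ger0_norm ?addr_ge0// -sqrtr_sqr.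
rewrite ler_sqrt ?sqr_ge0// sqrrD !real_normK ?num_real//.
by rewrite lerD2r lerDl mulrn_wge0// mulr_ge0.
Qed.

Lemma lt_normcR (z : C) (e : R) : (`|z| < (e%:C)%C) = (Normc.normc z < e).
Proof. by rewrite normcE ltcR. Qed.

Lemma pos_complexR (e : C) : 0 < e -> exists2 d : R, 0 < d & e = (d%:C)%C.
Proof.
case: e => x y; rewrite ltcE/= => /andP[/eqP -> x0].
by exists x.
Qed.

Lemma continuous_Re : continuous (@complex.Re R : C^o -> R).
Proof.
move=> z; apply/(@cvgrPdist_lt _ R^o C^o (nbhs z) (nbhs_filter z)) => e e0.
have ec0 : 0 < (e%:C)%C by rewrite ltcR.
apply: (@filterS C^o _ (nbhs_filter z) _ _ _ (nbhsx_ballx (z : C^o) _ ec0)) => w.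
rewrite -ball_normE/= lt_normcR; apply: le_lt_trans.
apply: le_trans (Re_le_normc _).
by rewrite -raddfB.
Qed.

Lemma continuous_Im : continuous (@complex.Im R : C^o -> R).
Proof.
move=> z; apply/(@cvgrPdist_lt _ R^o C^o (nbhs z) (nbhs_filter z)) => e e0.
have ec0 : 0 < (e%:C)%C by rewrite ltcR.
apply: (@filterS C^o _ (nbhs_filter z) _ _ _ (nbhsx_ballx (z : C^o) _ ec0)) => w.
rewrite -ball_normE/= lt_normcR; apply: le_lt_trans.
apply: le_trans (Im_le_normc _).
by rewrite -raddfB.
Qed.

Lemma continuous_real_complex : continuous (fun x : R => (x%:C)%C : C^o).
Proof.
move=> x; apply/cvgrPdist_lt => e /pos_complexR[d d0 ->].
near=> y.
have : `|x - y| < d by near: y; exact: cvgr_dist_lt.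
by rewrite lt_normcR -rmorphB normc_real.
Unshelve. all: by end_near. Qed.

Lemma continuous_Re_comp f : continuous (f : R -> C^o) -> continuous (fun x => complex.Re (f x)).
Proof. by move=> cf x; apply: continuous_comp (cf x) _; exact: continuous_Re. Qed.

Lemma continuous_Im_comp f : continuous (f : R -> C^o) -> continuous (fun x => complex.Im (f x)).
Proof. by move=> cf x; apply: continuous_comp (cf x) _; exact: continuous_Im. Qed.

Lemma continuous_of_real (f : R -> R) : continuous f ->
  continuous (fun x => ((f x)%:C)%C : C^o).
Proof.
move=> cf x; apply: continuous_comp (cf x) _.
exact: continuous_real_complex.
Qed.

Lemma ReD (z w : C) : complex.Re (z + w) = complex.Re z + complex.Re w.
Proof. by case: z; case: w. Qed.

Lemma ImD (z w : C) : complex.Im (z + w) = complex.Im z + complex.Im w.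
Proof. by case: z; case: w. Qed.

Lemma ReN (z : C) : complex.Re (- z) = - complex.Re z.
Proof. by case: z. Qed.

Lemma ImN (z : C) : complex.Im (- z) = - complex.Im z.
Proof. by case: z. Qed.

(** Taken by components because the variable is real while [C] is normed over itself; theorems of
    real analysis then apply to each component. *)
Definition cderive (f df : R -> C) := forall x : R,
  is_derive x (1 : R) (fun t => complex.Re (f t)) (complex.Re (df x)) /\
  is_derive x (1 : R) (fun t => complex.Im (f t)) (complex.Im (df x)).

Lemma cderive_ext f g df : f =1 g -> cderive f df -> cderive g df.
Proof. by move=> /funext ->. Qed.

Lemma cderive_eq f df dg : df =1 dg -> cderive f df -> cderive f dg.
Proof. by move=> /funext ->. Qed.

Lemma cderive_cst z : cderive (fun _ => z) (fun _ => 0).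
Proof. by move=> x; split; exact: is_derive_cst. Qed.

Lemma cderive_real (f df : R -> R) : (forall x, is_derive x (1 : R) f (df x)) ->
  cderive (fun x => ((f x)%:C)%C) (fun x => ((df x)%:C)%C).
Proof. by move=> h x; split => //=; exact: is_derive_cst. Qed.

Lemma cderiveD f df g dg : cderive f df -> cderive g dg ->
  cderive (fun x => f x + g x) (fun x => df x + dg x).
Proof.
move=> hf hg x; have [f1 f2] := hf x; have [g1 g2] := hg x; split.
- under eq_fun do rewrite ReD.
  by rewrite ReD; exact: is_deriveD.
- under eq_fun do rewrite ImD.
  by rewrite ImD; exact: is_deriveD.
Qed.

Lemma ReM (z w : C) : complex.Re (z * w) =
  complex.Re z * complex.Re w - complex.Im z * complex.Im w.
Proof. by case: z; case: w. Qed.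

Lemma ImM (z w : C) : complex.Im (z * w) =
  complex.Re z * complex.Im w + complex.Im z * complex.Re w.
Proof. by case: z; case: w. Qed.

Lemma cderiveM f df g dg : cderive f df -> cderive g dg ->
  cderive (fun x => f x * g x) (fun x => df x * g x + f x * dg x).
Proof.
move=> hf hg x; have [f1 f2] := hf x; have [g1 g2] := hg x; split.
- under eq_fun do rewrite ReM.
  apply: is_derive_eq; rewrite ReD !ReM /GRing.scale/=; ring.
- under eq_fun do rewrite ImM.
  apply: is_derive_eq; rewrite ImD !ImM /GRing.scale/=; ring.
Qed.

Lemma cderiveN f df : cderive f df -> cderive (fun x => - f x) (fun x => - df x).
Proof.
move=> hf; have := cderiveM (cderive_cst (-1)) hf.
under eq_fun do rewrite mulN1r.
by apply: cderive_eq => x; rewrite mul0r add0r mulN1r.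
Qed.

Lemma cderiveX2 f df : cderive f df ->
  cderive (fun x => f x ^+ 2) (fun x => 2 * f x * df x).
Proof.
move=> hf; have := cderiveM hf hf.
by apply: cderive_eq => x; ring.
Qed.

Lemma cderiveV f df : (forall x, f x != 0) -> cderive f df ->
  cderive (fun x => (f x)^-1) (fun x => - df x * (f x)^-1 ^+ 2).
Proof.
move=> f0 hf x; have [f1 f2] := hf x.
have n0 : complex.Re (f x) ^+ 2 + complex.Im (f x) ^+ 2 != 0.
  apply: contra (f0 x); rewrite paddr_eq0 ?sqr_ge0// !sqrf_eq0.
  by case: (f x) => a b /=; rewrite eq_complex.
have iV (z : C) : complex.Re z^-1 = complex.Re z * (complex.Re z ^+ 2 + complex.Im z ^+ 2)^-1
    /\ complex.Im z^-1 = - complex.Im z * (complex.Re z ^+ 2 + complex.Im z ^+ 2)^-1.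
  by case: z => a b; split => //=; rewrite mulNr.
have hN : is_derive x (1 : R) (fun t => complex.Re (f t) ^+ 2 + complex.Im (f t) ^+ 2)
    (2 * complex.Re (f x) * complex.Re (df x) + 2 * complex.Im (f x) * complex.Im (df x)).
  by apply: is_derive_eq; rewrite /GRing.scale/=; ring.
have hV := @is_deriveV R (fun t => complex.Re (f t) ^+ 2 + complex.Im (f t) ^+ 2) x _ 1 n0 hN.
split.
- under eq_fun do rewrite (iV _).1.
  apply: is_derive_eq.
  rewrite !expr2 !(ReM, ImM, ReN, ImN, (iV (f x)).1, (iV (f x)).2) /GRing.scale/= !expr2.
  rewrite !expr2 in n0.
  move: n0; set p := complex.Re (f x); set q := complex.Im (f x) => n0.
  by field.
- under eq_fun do rewrite (iV _).2.
  apply: is_derive_eq.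
  rewrite !expr2 !(ReM, ImM, ReN, ImN, (iV (f x)).1, (iV (f x)).2) /GRing.scale/= !expr2.
  rewrite !expr2 in n0.
  move: n0; set p := complex.Re (f x); set q := complex.Im (f x) => n0.
  by field.
Qed.

End ComplexCalculus.

(** * Change of variables with singular endpoints *)

Section Substitution.
Local Open Scope ring_scope.
Variable R : realType.
Local Notation mu := (@lebesgue_measure R).
Variables (F dF : R -> R) (a b : R).
Hypothesis ab : a < b.
Hypothesis incF : {in `[a, b] &, {homo F : x y / x < y}}.
Hypothesis dFE : forall x : R, is_derive x (1 : R) F (dF x).
Hypothesis cdF : continuous dF.
Hypothesis dF_gt0 : {in `]a, b[, forall x, 0 < dF x}.

(** The 3 keeps [[a + e n, b - e n]] nondegenerate already at n = 0, where [harmonic] is 1. *)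
Let e (n : nat) : R := (b - a) / 3 * harmonic n.

Let ba3_gt0 : 0 < (b - a) / 3.
Proof. by rewrite divr_gt0// subr_gt0. Qed.

Let e_gt0 n : 0 < e n.
Proof. by rewrite mulr_gt0// harmonic_gt0. Qed.

Let e_le n m : (n <= m)%N -> e m <= e n.
Proof. by move=> nm; rewrite ler_pM2l// lef_pV2 ?posrE// ler_nat. Qed.

Let e_lt n : a + e n < b - e n.
Proof.
have : e n <= e 0 by exact: e_le.
have -> : e 0%N = (b - a) / 3 by rewrite /e /harmonic/= invr1 mulr1.
by move: ab; lra.
Qed.

Let e_cvg : e @ \oo --> (0 : R).
Proof.
rewrite -[X in _ --> X](mulr0 ((b - a) / 3)).
exact: cvgM (cvg_cst _) cvg_harmonic.
Qed.

Let A n : set R := `[a + e n, b - e n]%classic.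
Let B n : set R := `[F (a + e n), F (b - e n)]%classic.

Let cF : continuous F.
Proof.
move=> x; apply: differentiable_continuous; apply/derivable1_diffP.
by have [] := dFE x.
Qed.

Let itvA n x : x \in `[a + e n, b - e n] -> x \in `]a, b[.
Proof.
have := e_gt0 n; rewrite !in_itv/= => ? /andP[? ?]; apply/andP; split; lra.
Qed.

Let incFE : {in `[a, b] &, {mono F : x y / x < y}}.
Proof. by apply: leW_mono_in; exact: le_mono_in. Qed.

Let bigcupA : \bigcup_n A n = `]a, b[%classic.
Proof.
apply/seteqP; split => [x [n _] /itvA//|x /=].
rewrite in_itv/= => /andP[ax xb].
have : \forall n \near \oo, e n < Num.min (x - a) (b - x).
  by apply: cvgr_lt e_cvg _ _; rewrite lt_min !subr_gt0 ax.
case=> n _ /(_ n (leqnn n)); rewrite lt_min => /andP[h1 h2].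
exists n => //; rewrite /A/= in_itv/=; apply/andP; split; lra.
Qed.

Let a_in : a \in `[a, b]. Proof. by rewrite in_itv/= lexx ltW. Qed.
Let b_in : b \in `[a, b]. Proof. by rewrite in_itv/= lexx ltW. Qed.
Let an_in n : a + e n \in `[a, b].
Proof. by have := e_gt0 n; have := e_lt n; rewrite in_itv/= => *; apply/andP; split; lra. Qed.
Let bn_in n : b - e n \in `[a, b].
Proof. by have := e_gt0 n; have := e_lt n; rewrite in_itv/= => *; apply/andP; split; lra. Qed.

Let itvB n y : y \in `[F (a + e n), F (b - e n)] -> y \in `]F a, F b[.
Proof.
rewrite !in_itv/= => /andP[h1 h2]; apply/andP; split.
- by apply: lt_le_trans h1; rewrite incFE// ltrDl.
- by apply: le_lt_trans h2 _; rewrite incFE// ltrBlDr ltrDl.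
Qed.

Let bigcupB : \bigcup_n B n = `]F a, F b[%classic.
Proof.
apply/seteqP; split => [x [n _] /itvB//|y /=].
rewrite in_itv/= => /andP[ay yb].
have h1 : \forall n \near \oo, F (a + e n) < y.
  apply: cvgr_lt ay; apply: continuous_cvg; first exact: cF.
  by rewrite -[X in _ --> X]addr0; apply: cvgD => //; exact: cvg_cst.
have h2 : \forall n \near \oo, y < F (b - e n).
  apply: cvgr_gt yb; apply: continuous_cvg; first exact: cF.
  by rewrite -[X in _ --> X]subr0; apply: cvgB => //; exact: cvg_cst.
case: (filterI h1 h2) => n _ /(_ n (leqnn n))[h3 h4].
by exists n => //; rewrite /B/= in_itv/= !ltW.
Qed.

(** [h] may blow up at [F a] and [F b], so the usual substitution is made on the compact intervals
    [A n] and [B n], and monotone convergence exhausts the open ones. *)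
Lemma ge0_integral_subst_oo (h g : R -> R) :
  {in `]F a, F b[, continuous h} ->
  (forall y, y \in `]F a, F b[ -> 0 <= h y) ->
  continuous g ->
  {in `]a, b[, forall x, h (F x) * dF x = g x} ->
  (\int[mu]_(y in `]F a, F b[) (h y)%:E = \int[mu]_(x in `]a, b[) (g x)%:E)%E.
Proof.
move=> ch h0 cg hg.
have mh : measurable_fun `]F a, F b[%classic h.
  apply: open_continuous_measurable_fun; first exact: interval_open.
  by move=> y /set_mem yy; exact: ch.
have mg : measurable_fun setT g by exact: continuous_measurable_fun.
have dF1 : derive1 F = dF.
  by apply/funext => x; rewrite derive1E (@derive_val _ _ _ _ _ _ _ (dFE x)).
have sub n : (\int[mu]_(y in B n) (h y)%:E = \int[mu]_(x in A n) (g x)%:E)%E.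
  rewrite /A /B (@integration_by_substitution_increasing _ F h).
  - rewrite dF1; apply: eq_integral => x /set_mem xA.
    by rewrite -hg//; exact: itvA xA.
  - exact/ltW/e_lt.
  - move=> x y xA yA; apply: incF.
      exact: subset_itv_oo_cc (itvA xA).
    exact: subset_itv_oo_cc (itvA yA).
  - by rewrite dF1 => x _; exact: cdF.
  - by rewrite dF1; apply: cvgP; apply: cvg_at_right_filter; exact: cdF.
  - by rewrite dF1; apply: cvgP; apply: cvg_at_left_filter; exact: cdF.
  - split.
    + by move=> x _; have [] := dFE x.
    + by apply: cvg_at_right_filter; exact: cF.
    + by apply: cvg_at_left_filter; exact: cF.
  - apply: continuous_in_subspaceT => y /set_mem /itvB yB.
    exact: ch.
have cvgB : (\int[mu]_(y in B n) (h y)%:E @[n --> \oo] -->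
    \int[mu]_(y in `]F a, F b[) (h y)%:E)%E.
  rewrite -bigcupB; apply: ge0_nondecreasing_set_cvg_integral.
  - move=> n m nm; apply/subsetPset; apply: subset_itv.
      rewrite bnd_simp.
      by rewrite (le_mono_in incF)// lerD2l e_le.
    rewrite bnd_simp.
    by rewrite (le_mono_in incF)// lerD2l lerN2 e_le.
  - by move=> n; exact: measurable_itv.
  - move=> n; apply/measurable_EFinP; apply: measurable_funS mh => //.
    by move=> y /itvB.
  - by move=> n y /itvB yB; rewrite lee_fin h0.
have g0 x : x \in `]a, b[ -> 0 <= g x.
  move=> xab; rewrite -hg// mulr_ge0//; last exact/ltW/dF_gt0.
  apply: h0; move: (xab); rewrite !in_itv/= => /andP[ax xb].
  have xin : x \in `[a, b] by exact: subset_itv_oo_cc.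
  by rewrite !incFE// ax.
have cvgA : (\int[mu]_(x in A n) (g x)%:E @[n --> \oo] -->
    \int[mu]_(x in `]a, b[) (g x)%:E)%E.
  rewrite -bigcupA; apply: ge0_nondecreasing_set_cvg_integral.
  - move=> n m nm; apply/subsetPset; apply: subset_itv; rewrite bnd_simp.
      by rewrite lerD2l e_le.
    by rewrite lerD2l lerN2 e_le.
  - by move=> n; exact: measurable_itv.
  - by move=> n; apply/measurable_EFinP; exact: measurable_funS mg.
  - by move=> n y /itvA yA; rewrite lee_fin g0.
apply: cvg_unique cvgB _ => //.
by rewrite (funext sub).
Qed.

(** Positive and negative parts reduce to the nonnegative case, since multiplication by [dF x > 0]
    commutes with the maximum with 0. *)
Lemma Rintegral_subst (h g : R -> R) :
  {in `]F a, F b[, continuous h} ->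
  continuous g ->
  {in `]a, b[, forall x, h (F x) * dF x = g x} ->
  (\int[mu]_(y in `[F a, F b]) h y = \int[mu]_(x in `[a, b]) g x)%R.
Proof.
move=> ch cg hg.
have mh : measurable_fun `]F a, F b[%classic h.
  apply: open_continuous_measurable_fun; first exact: interval_open.
  by move=> y /set_mem yy; exact: ch.
have mg : measurable_fun setT g by exact: continuous_measurable_fun.
rewrite /Rintegral integral_itv_bndoo; last exact/measurable_EFinP.
rewrite [in RHS]integral_itv_bndoo; last first.
  by apply/measurable_EFinP; exact: measurable_funS mg.
congr fine; rewrite integralE [RHS]integralE; congr (_ - _)%E.
- under eq_integral do rewrite funeposE -fine_max//.
  under [in RHS]eq_integral do rewrite funeposE -fine_max//.
  apply: (@ge0_integral_subst_oo (fun y => Num.max (h y) 0) (fun x => Num.max (g x) 0)).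
  + move=> y yF; apply: (@continuous_max R R h (cst 0) y); last exact: cvg_cst.
    exact: (ch y yF).
  + by move=> y _; rewrite le_max lexx orbT.
  + move=> y; apply: (@continuous_max R R g (cst 0) y); last exact: cvg_cst.
    exact: (cg y).
  + by move=> x xab; rewrite maxr_pMl ?ltW ?dF_gt0// hg// mul0r.
- under eq_integral do rewrite funenegE -fine_max//.
  under [in RHS]eq_integral do rewrite funenegE -fine_max//.
  apply: (@ge0_integral_subst_oo (fun y => Num.max (- h y) 0) (fun x => Num.max (- g x) 0)).
  + move=> y yF; apply: (@continuous_max R R (fun y => - h y) (cst 0) y); last exact: cvg_cst.
    exact: (cvgN (ch y yF)).
  + by move=> y _; rewrite le_max lexx orbT.
  + move=> y; apply: (@continuous_max R R (fun y => - g y) (cst 0) y); last exact: cvg_cst.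
    exact: (cvgN (cg y)).
  + by move=> x xab; rewrite maxr_pMl ?ltW ?dF_gt0// mulNr hg// mul0r.
Qed.

End Substitution.

(** * Complex integrals depending on a real parameter *)

Section ComplexIntegral.
Local Open Scope ring_scope.
Variable R : realType.
Local Notation C := R[i].
Local Notation mu := (@lebesgue_measure R).
Implicit Types (f g : R -> C) (z : C) (a b : R).

Definition ccontinuous f := continuous (f : R -> C^o).

Lemma continuous_integrable_itv (f : R -> R) a b : continuous f ->
  mu.-integrable `[a, b] (EFin \o f).
Proof.
move=> cf; apply: continuous_compact_integrable; first exact: segment_compact.
by apply: continuous_subspaceT => x; exact: cf.
Qed.

Lemma Re_Cintegral (D : set R) f :
  complex.Re (Cintegral D f) = \int[mu]_(x in D) complex.Re (f x).
Proof. by []. Qed.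

Lemma Im_Cintegral (D : set R) f :
  complex.Im (Cintegral D f) = \int[mu]_(x in D) complex.Im (f x).
Proof. by []. Qed.

Lemma complex_ext (z w : C) : complex.Re z = complex.Re w ->
  complex.Im z = complex.Im w -> z = w.
Proof. by case: z => ? ?; case: w => ? ? /= -> ->. Qed.

Lemma eq_Cintegral (D : set R) f g : {in D, f =1 g} -> Cintegral D f = Cintegral D g.
Proof.
by move=> fg; congr (Complex _ _); apply: eq_Rintegral => x xD; rewrite fg.
Qed.

Lemma integrable_Re a b f : ccontinuous f ->
  mu.-integrable `[a, b] (EFin \o (fun x => complex.Re (f x))).
Proof. by move=> cf; apply: continuous_integrable_itv; exact: continuous_Re_comp. Qed.

Lemma integrable_Im a b f : ccontinuous f ->
  mu.-integrable `[a, b] (EFin \o (fun x => complex.Im (f x))).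
Proof. by move=> cf; apply: continuous_integrable_itv; exact: continuous_Im_comp. Qed.

Lemma CintegralD a b f g : ccontinuous f -> ccontinuous g ->
  Cintegral `[a, b] (fun x => f x + g x) = Cintegral `[a, b] f + Cintegral `[a, b] g.
Proof.
move=> cf cg; apply: complex_ext; rewrite ?ReD ?ImD !(Re_Cintegral, Im_Cintegral).
- under eq_Rintegral do rewrite ReD.
  by rewrite RintegralD//; [exact: integrable_Re|exact: integrable_Re].
- under eq_Rintegral do rewrite ImD.
  by rewrite RintegralD//; [exact: integrable_Im|exact: integrable_Im].
Qed.

Lemma CintegralZ a b z f : ccontinuous f ->
  Cintegral `[a, b] (fun x => z * f x) = z * Cintegral `[a, b] f.
Proof.
move=> cf; have iR := @integrable_Re a b f cf; have iI := @integrable_Im a b f cf.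
have iZ (r : R) (h : R -> R) : mu.-integrable `[a, b] (EFin \o h) ->
    mu.-integrable `[a, b] (EFin \o (fun x => r * h x)).
  by move=> ih; have := integrableZl _ r ih; exact.
apply: complex_ext; rewrite ?ReM ?ImM !(Re_Cintegral, Im_Cintegral).
- under eq_Rintegral do rewrite ReM.
  by rewrite RintegralB ?RintegralZl//; exact: iZ.
- under eq_Rintegral do rewrite ImM.
  by rewrite RintegralD ?RintegralZl//; exact: iZ.
Qed.

Lemma normc_Cintegral_le a b f (M : R) : a <= b -> ccontinuous f ->
  (forall x, Normc.normc (f x) <= M) ->
  Normc.normc (Cintegral `[a, b] f) <= 2 * (b - a) * M.
Proof.
move=> ab cf fM.
have key (h : R -> R) : continuous h -> (forall x, `|h x| <= M) ->
    `|\int[mu]_(x in `[a, b]) h x| <= (b - a) * M.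
  move=> ch hM; have ih := @continuous_integrable_itv h a b ch.
  apply: (le_trans (le_normr_Rintegral _ _)) => //.
  have -> : (b - a) * M = \int[mu]_(x in `[a, b]) M.
    rewrite Rintegral_cst// mulrC; congr (_ * _).
    have := lebesgue_measure_itv `[a, b] => /= ->; rewrite lte_fin.
    have [//|ba] := ltP a b; have /eqP -> : a == b by rewrite eq_le ab.
    by rewrite subrr.
  apply: le_Rintegral => //.
  - by have := integrable_norm ih.
  - by apply: continuous_integrable_itv; exact: cst_continuous.
apply: (le_trans (normc_le_ReIm _)).
rewrite Re_Cintegral Im_Cintegral -mulrA mulr_natl mulr2n lerD//; apply: key.
- exact: continuous_Re_comp.
- by move=> x; apply: le_trans (fM x); exact: Re_le_normc.
- exact: continuous_Im_comp.
- by move=> x; apply: le_trans (fM x); exact: Im_le_normc.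
Qed.

Lemma Cintegral_cderive a b f df : a < b -> cderive f df -> ccontinuous df ->
  Cintegral `[a, b] df = f b - f a.
Proof.
move=> ab dfE cdf.
have key (h dh : R -> R) : (forall x : R, is_derive x (1:R) h (dh x)) -> continuous dh ->
    \int[mu]_(x in `[a, b]) dh x = h b - h a.
  move=> hE ch; rewrite /Rintegral (@continuous_FTC2 _ dh h)//.
  - by apply: continuous_subspaceT => x; exact: ch.
  - have cth : continuous h.
      move=> x; apply: differentiable_continuous; apply/derivable1_diffP.
      by have [] := hE x.
    split; first by move=> x _; have [] := hE x.
    + by apply: cvg_at_right_filter; exact: cth.
    + by apply: cvg_at_left_filter; exact: cth.
  - by move=> x _; rewrite derive1E (@derive_val _ _ _ _ _ _ _ (hE x)).
apply: complex_ext; rewrite ?(ReD, ImD, ReN, ImN).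
- apply: (key (fun x => complex.Re (f x)) (fun x => complex.Re (df x))).
    by move=> x; have [] := dfE x.
  exact: continuous_Re_comp.
- apply: (key (fun x => complex.Im (f x)) (fun x => complex.Im (df x))).
    by move=> x; have [] := dfE x.
  exact: continuous_Im_comp.
Qed.

(** A class stable under ring operations, and under inversion away from 0, in which a constant
    dominates: continuity and differentiation under the integral sign over a bounded interval follow
    by dominated convergence. *)
Definition tame (g : R -> R -> C) :=
  [/\ forall t, ccontinuous (g t), forall x, ccontinuous (g^~ x) &
      exists M : R, forall t x, Normc.normc (g t x) <= M].

Lemma tame_cst z : tame (fun _ _ => z).
Proof.
split; [by move=> t x; exact: cvg_cst|by move=> t x; exact: cvg_cst|].
by exists (Normc.normc z).
Qed.

Lemma tameD (f g : R -> R -> C) : tame f -> tame g -> tame (fun t x => f t x + g t x).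
Proof.
move=> [f1 f2 [M fM]] [g1 g2 [N gN]]; split.
- by move=> t x; apply: (@cvgD C C^o); [exact: f1|exact: g1].
- by move=> t x; apply: (@cvgD C C^o); [exact: f2|exact: g2].
- by exists (M + N) => t x; apply: (le_trans (le_normcD _ _)); rewrite lerD.
Qed.

Lemma tameM (f g : R -> R -> C) : tame f -> tame g -> tame (fun t x => f t x * g t x).
Proof.
move=> [f1 f2 [M fM]] [g1 g2 [N gN]]; split.
- by move=> t x; apply: (@cvgM C); [exact: f1|exact: g1].
- by move=> t x; apply: (@cvgM C); [exact: f2|exact: g2].
- by exists (M * N) => t x; rewrite Normc.normcM ler_pM ?normc_ge0.
Qed.

Lemma tameN (f : R -> R -> C) : tame f -> tame (fun t x => - f t x).
Proof.
move=> tf; have := tameM (tame_cst (-1)) tf.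
by under eq_fun do under eq_fun do rewrite mulN1r.
Qed.

Lemma tameX (f : R -> R -> C) n : tame f -> tame (fun t x => f t x ^+ n).
Proof.
move=> tf; elim: n => [|n IH].
  by under eq_fun do under eq_fun do rewrite expr0; exact: tame_cst.
by under eq_fun do under eq_fun do rewrite exprS; exact: tameM.
Qed.

Lemma tameV (f : R -> R -> C) (d : R) : 0 < d -> (forall t x, d <= Normc.normc (f t x)) ->
  tame f -> tame (fun t x => (f t x)^-1).
Proof.
move=> d0 fd [f1 f2 _].
have f0 t x : f t x != 0.
  by apply/eqP => h; have := fd t x; rewrite h Normc.normc0 leNgt d0.
split.
- by move=> t x; apply: (@cvgV C); [exact: f0|exact: f1].
- by move=> t x; apply: (@cvgV C); [exact: f0|exact: f2].
- exists d^-1 => t x; rewrite Normc.normcV lef_pV2// posrE//.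
  exact: lt_le_trans (fd t x).
Qed.

Lemma tame_fst (h : R -> R) (M : R) : continuous h -> (forall x, `|h x| <= M) ->
  tame (fun t _ => ((h t)%:C)%C).
Proof.
move=> ch hM; split.
- by move=> t x; exact: cvg_cst.
- by move=> t; exact: continuous_of_real ch.
- by exists M => t x; rewrite normc_real.
Qed.

Lemma tame_snd (h : R -> R) (M : R) : continuous h -> (forall x, `|h x| <= M) ->
  tame (fun _ x => ((h x)%:C)%C).
Proof.
move=> ch hM; split.
- by move=> t; exact: continuous_of_real ch.
- by move=> t x; exact: cvg_cst.
- by exists M => t x; rewrite normc_real.
Qed.

Lemma ccontinuous_tame_Cintegral c d (g : R -> R -> C) : tame g ->
  ccontinuous (fun t => Cintegral `[c, d] (g t)).
Proof.
move=> [g1 g2 [M gM]].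
have key (h : R -> R -> R) : (forall t, continuous (h t)) -> (forall x, continuous (h^~ x)) ->
    (forall t x, `|h t x| <= M) -> continuous (fun t => \int[mu]_(x in `[c, d]) h t x).
  move=> h1 h2 hM t.
  apply: (@continuity_under_integral _ _ _ mu h `[c, d]%classic _ (t - 1) (t + 1)
    _ _ (cst M)) => //.
  - by move=> x _; exact: (@continuous_integrable_itv (h x) c d (h1 x)).
  - by apply: aeW => x _ s _; exact: h2.
  - by apply: continuous_integrable_itv; exact: cst_continuous.
  - by move=> s _; apply: aeW => x _; exact: hM.
  - by rewrite inE/= in_itv/= ltrBlDr !ltrDl ltr01.
have -> : (fun t => Cintegral `[c, d] (g t)) = (fun t =>
   ((\int[mu]_(x in `[c, d]) complex.Re (g t x))%:C)%C +
   (Complex 0 1) * ((\int[mu]_(x in `[c, d]) complex.Im (g t x))%:C)%C).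
  by apply/funext => t; rewrite -Re_Cintegral -Im_Cintegral -complexE.
move=> t; apply: (@cvgD C C^o); last apply: (@cvgM C); last 1 first.
- apply: continuous_of_real; apply: key.
  + by move=> s; exact: (continuous_Im_comp (g1 s)).
  + by move=> s; exact: (continuous_Im_comp (g2 s)).
  + by move=> s x; apply: le_trans (gM s x); exact: Im_le_normc.
- apply: continuous_of_real; apply: key.
  + by move=> s; exact: (continuous_Re_comp (g1 s)).
  + by move=> s; exact: (continuous_Re_comp (g2 s)).
  + by move=> s x; apply: le_trans (gM s x); exact: Re_le_normc.
- exact: cvg_cst.
Qed.

Lemma cderive_Cintegral c d (g dg : R -> R -> C) : tame g -> tame dg ->
  (forall x, cderive (g^~ x) (dg^~ x)) ->
  cderive (fun t => Cintegral `[c, d] (g t)) (fun t => Cintegral `[c, d] (dg t)).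
Proof.
move=> [g1 g2 [M gM]] [dg1 dg2 [N dgN]] gdg.
have key (h dh : R -> R -> R) : (forall t, continuous (h t)) ->
    (forall t x, is_derive t (1:R) (h^~ x) (dh t x)) ->
    (forall t x, `|dh t x| <= N) ->
    forall t : R, is_derive t (1 : R) (fun t => \int[mu]_(x in `[c, d]) h t x)
      (\int[mu]_(x in `[c, d]) dh t x).
  move=> h1 hdh dhN t.
  have p1 : partial1of2 h = dh.
    apply/funext => s; apply/funext => x.
    by rewrite partial1of2E (@derive_val _ _ _ _ _ _ _ (hdh s x)).
  have tI : `]t - 1, t + 1[%classic t by rewrite /= in_itv/= ltrBlDr !ltrDl ltr01.
  have N0 : 0 <= N by apply: le_trans (dhN 0 0).
  have iN : mu.-integrable `[c, d] (EFin \o (cst N : R -> R)).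
    by apply: continuous_integrable_itv; exact: cst_continuous.
  apply: DeriveDef.
    apply: (@derivable_under_integral _ _ _ mu h `[c, d]%classic _ t _ _ tI _ _ (cst N)) => //.
    - by move=> x _; exact: (@continuous_integrable_itv (h x) c d (h1 x)).
    - by move=> s x _ _; rewrite p1.
  rewrite -derive1E.
  rewrite (@differentiation_under_integral _ _ _ mu h `[c, d]%classic _ t _ _ tI _ _ (cst N)) //.
  - by rewrite p1.
  - by move=> x _; exact: (@continuous_integrable_itv (h x) c d (h1 x)).
  - by move=> s x _ _; rewrite p1.
move=> t; split; apply: (key (fun t x => _ (g t x)) (fun t x => _ (dg t x))).
- by move=> s; exact: (continuous_Re_comp (g1 s)).
- by move=> s x; have [] := gdg x s.
- by move=> s x; apply: le_trans (dgN s x); exact: Re_le_normc.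
- by move=> s; exact: (continuous_Im_comp (g1 s)).
- by move=> s x; have [] := gdg x s.
- by move=> s x; apply: le_trans (dgN s x); exact: Im_le_normc.
Qed.

End ComplexIntegral.

(** * The measure in angular coordinates *)

Section Parametrization.
Local Open Scope ring_scope.
Variable R : realType.
Local Notation C := R[i].
Local Notation mu := (@lebesgue_measure R).

Lemma eq_Cintegral_oo (a b : R) (f g : R -> C) :
  {in `]a, b[, forall x, {for x, continuous (g : R -> C^o)}} ->
  {in `]a, b[, f =1 g} -> Cintegral `[a, b] f = Cintegral `[a, b] g.
Proof.
move=> cg fg.
have key (p q : R -> R) : {in `]a, b[, continuous q} -> {in `]a, b[, p =1 q} ->
    \int[mu]_(x in `[a, b]) p x = \int[mu]_(x in `[a, b]) q x.
  move=> cq pq.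
  have mq : measurable_fun `]a, b[%classic q.
    apply: open_continuous_measurable_fun; first exact: interval_open.
    by move=> y /set_mem yy; exact: cq.
  rewrite /Rintegral; congr fine; apply: eq_integral_itv_bounded => //.
  by apply: eq_measurable_fun mq => x /set_mem xab; rewrite pq.
apply: complex_ext; rewrite !(Re_Cintegral, Im_Cintegral); apply: key.
- move=> x xab; apply: (@continuous_comp R C^o R); first exact: cg.
  exact: continuous_Re.
- by move=> x xab; rewrite fg.
- move=> x xab; apply: (@continuous_comp R C^o R); first exact: cg.
  exact: continuous_Im.
- by move=> x xab; rewrite fg.
Qed.

Lemma Cintegral_subst (F dF : R -> R) (a b : R) (h g : R -> C) :
  a < b ->
  {in `[a, b] &, {homo F : x y / x < y}} ->
  (forall x : R, is_derive x (1 : R) F (dF x)) ->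
  continuous dF ->
  {in `]a, b[, forall x, 0 < dF x} ->
  {in `]F a, F b[, forall x, {for x, continuous (h : R -> C^o)}} ->
  ccontinuous g ->
  {in `]a, b[, forall x, h (F x) * ((dF x)%:C)%C = g x} ->
  Cintegral `[F a, F b] h = Cintegral `[a, b] g.
Proof.
move=> ab incF dFE cdF dF0 ch cg hg.
apply: complex_ext; rewrite !(Re_Cintegral, Im_Cintegral).
- apply: (Rintegral_subst ab incF dFE cdF dF0).
  + move=> x xab; apply: (@continuous_comp R C^o R); first exact: ch.
    exact: continuous_Re.
  + exact: continuous_Re_comp.
  + by move=> x xab; rewrite -hg// ReM mulr0 subr0.
- apply: (Rintegral_subst ab incF dFE cdF dF0).
  + move=> x xab; apply: (@continuous_comp R C^o R); first exact: ch.
    exact: continuous_Im.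
  + exact: continuous_Im_comp.
  + by move=> x xab; rewrite -hg// ImM mulr0 add0r.
Qed.

(** A nonnegative real factor leaves the argument unchanged, so no sign ambiguity arises. This turns
    the root of psi(sin t) into [sin t * cos t * sqrtc (- w)], which is smooth in t. *)
Lemma sqrtc_scale (r : R) (z : C) : 0 <= r ->
  sqrtc (((r ^+ 2)%:C)%C * z) = (r%:C)%C * sqrtc z.
Proof.
rewrite le_eqVlt => /predU1P[<-|r0]; first by rewrite expr0n !mul0r sqrtc0.
case: z => x y; rewrite /sqrtc/= !mul0r !subr0 !addr0.
have r2 : 0 < r ^+ 2 by rewrite exprn_gt0.
have -> : Num.sqrt ((r ^+ 2 * x) ^+ 2 + (r ^+ 2 * y) ^+ 2) =
    r ^+ 2 * Num.sqrt (x ^+ 2 + y ^+ 2).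
  rewrite -[in RHS](gtr0_norm r2) -sqrtr_sqr -sqrtrM ?sqr_ge0//.
  by rewrite !exprMn mulrDr.
have rS X : Num.sqrt (r ^+ 2 * X) = r * Num.sqrt X.
  by rewrite sqrtrM ?sqr_ge0// sqrtr_sqr (gtr0_norm r0).
rewrite -mulrDr -mulrBr -!(mulrA (r ^+ 2)) !rS mulf_eq0 (gt_eqF r2)/= sgrM (gtr0_sg r2) mul1r.
by apply: complex_ext; rewrite ?ReM ?ImM/= mul0r ?subr0 ?addr0 // mulrCA.
Qed.

(** Along the segment the density in s is 1/(pi sqrt(s(1 - s))). With s = (1 - cos x)/2 the root
    equals sin x / 2, which is exactly ds/dx, so the law is uniform in the angle x. *)
Lemma arcsine_integralE (xi r : C) (f : C -> C) : r != 0 ->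
  ccontinuous (fun x : R => f (xi - 2 * r * ((cos x)%:C)%C)) ->
  arcsine_integral (xi - 2 * r) (xi + 2 * r) f =
  Cintegral `[0, pi] (fun x => f (xi - 2 * r * ((cos x)%:C)%C) * ((pi^-1)%:C)%C).
Proof.
move=> r0 cf; rewrite /arcsine_integral.
(* The detour through [acos] makes [h] continuous from the continuity of [f] along the segment
   alone. *)
pose h (s : R) : C := f (xi - 2 * r * ((cos (acos (1 - 2 * s)))%:C)%C) *
   (((pi * Num.sqrt (s * (1 - s)))^-1)%:C)%C.
pose F (x : R) : R := (1 - cos x) / 2.
have F0 : F 0 = 0 by rewrite /F cos0 subrr mul0r.
have F1 : F pi = 1 by rewrite /F cospi opprK divff.
have D0 : 0 < Normc.normc (xi + 2 * r - (xi - 2 * r)).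
  rewrite lt0r normc_ge0 andbT; apply: contra r0 => /eqP /Normc.eq0_normc h0.
  have {}h0 : 4 * r = 0 by rewrite -h0; ring.
  by move/eqP: h0; rewrite mulf_eq0 pnatr_eq0.
rewrite (@eq_Cintegral _ _ _ h); last first.
  move=> s; rewrite inE/= in_itv/= => /andP[s0 s1]; rewrite /h acosK; last first.
    by rewrite in_itv/=; apply/andP; split; lra.
  congr (f _ * _).
    by rewrite rmorphB rmorphM/= !rmorph1 rmorph_nat; ring.
  congr ((_)%:C)%C.
  set a1 := xi - 2 * r; set a2 := xi + 2 * r.
  have -> : (a1 + s%:C%C * (a2 - a1) - a1) * (a1 + s%:C%C * (a2 - a1) - a2) =
     (((s * (s - 1)))%:C)%C * (a2 - a1) ^+ 2.
    by rewrite rmorphM rmorphB rmorph1; ring.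
  rewrite Normc.normcM normcX normc_real.
  have -> : `|s * (s - 1)| = s * (1 - s).
    by rewrite normrM ger0_norm// ler0_norm ?subr_le0// opprB.
  rewrite sqrtrM ?mulr_ge0 ?subr_ge0//.
  rewrite sqrtr_sqr (gtr0_norm D0) mulrA invfM mulrCA divff ?mulr1//.
  by rewrite gt_eqF.
rewrite -[X in Cintegral `[X, _]]F0 -F1.
apply: (@Cintegral_subst F (fun x => sin x / 2)).
- exact: pi_gt0.
- move=> x y xp yp xy; rewrite /F ltr_pM2r// ltrD2l ltrN2.
  by rewrite ltr_cos.
- move=> x; rewrite /F.
  by apply: is_derive_eq; rewrite /GRing.scale/=; ring.
- move=> x; apply: (@cvgM R); last exact: cvg_cst.
  exact: continuous_sin.
- move=> x; rewrite in_itv/= => xp; rewrite divr_gt0//.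
  exact: sin_gt0_pi.
- move=> s; rewrite F0 F1 in_itv/= => /andP[s0 s1].
  apply: (@cvgM C).
    have : {for s, continuous (fun s : R => acos (1 - 2 * s))}.
      apply: (@continuous_comp R R R (fun s => 1 - 2 * s) acos).
        apply: (@continuousB R R^o R (cst 1) (fun s => 2 * s)); first exact: cst_continuous.
        by apply: (@continuousM R R (cst 2) id); [exact: cst_continuous|exact: cvg_id].
      by apply: continuous_acos; apply/andP; split; lra.
    move=> /(@continuous_comp R R C^o _ (fun x => f (xi - 2 * r * ((cos x)%:C)%C)) s); apply.
    exact: cf.
  apply: (@continuous_comp R R C^o (fun s => (pi * Num.sqrt (s * (1 - s)))^-1));
    last exact: continuous_real_complex.
  apply: (@continuousV R R (fun s => pi * Num.sqrt (s * (1 - s)))).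
    by rewrite mulf_neq0 ?gt_eqF ?pi_gt0// sqrtr_gt0 mulr_gt0// subr_gt0.
  apply: (@continuousM R R (cst pi) (fun s => Num.sqrt (s * (1 - s)))).
    exact: cst_continuous.
  apply: (@continuous_comp R R R (fun s => s * (1 - s)) Num.sqrt); last exact: sqrt_continuous.
  apply: (@continuousM R R id (fun s => 1 - s)); first exact: cvg_id.
  by apply: (@continuousB R R^o R (cst 1) id); [exact: cst_continuous|exact: cvg_id].
- by move=> x; apply: (@cvgM C); [exact: cf|exact: cvg_cst].
- move=> x; rewrite in_itv/= => /andP[x0 xpi].
  have sx : 0 < sin x by apply: sin_gt0_pi; rewrite x0.
  rewrite /h.
  have -> : 1 - 2 * F x = cos x by rewrite /F; field.
  rewrite cosK ?in_itv/= ?ltW//.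
  have -> : F x * (1 - F x) = (sin x / 2) ^+ 2.
    have := cos2Dsin2 x; rewrite /F => h1.
    have -> : (sin x / 2) ^+ 2 = (sin x ^+ 2) / 4 by field.
    by rewrite -(addrK (cos x ^+ 2) (sin x ^+ 2)) [_ + cos x ^+ 2]addrC h1; field.
  rewrite sqrtr_sqr gtr0_norm ?divr_gt0// -mulrA -rmorphM/=.
  congr (_ * (_)%:C%C).
  have p0 := pi_gt0 R; move: (pi : R) p0 => p p0.
  by field; rewrite !lt0r_neq0.
Qed.

(** The point xi(theta) - 2 sqrt(psi(theta)) cos x at theta = sin t, where [k] stands for a square
    root of - w. *)
Definition ell (a v k : C) (t x : R) : C :=
  a - v * ((sin t)%:C)%C ^+ 2 -
  2 * (k * ((sin t)%:C)%C * ((cos t)%:C)%C) * ((cos x)%:C)%C.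

(** The Jacobian cos t of theta = sin t joins the uniform density 1/pi; [cos t / pi] is the area
    element of the quarter sphere divided by its area pi. *)
Lemma M_integralE (a v w : C) (f : C -> C) : w != 0 ->
  tame (fun t x => f (ell a v (sqrtc (- w)) t x)) ->
  M_integral a v w f =
  Cintegral `[0, pi / 2] (fun t => Cintegral `[0, pi] (fun x =>
    ((cos t / pi)%:C)%C * f (ell a v (sqrtc (- w)) t x))).
Proof.
move=> w0 tf; set k := sqrtc (- w) in tf *.
have k0 : k != 0 by rewrite sqrtc_eq0 oppr_eq0.
have [c1 c2 _] := tf.
pose J (t : R) : C := Cintegral `[0, pi] (fun x => f (ell a v k t x) * ((pi^-1)%:C)%C).
have cJ : ccontinuous J.
  by apply: ccontinuous_tame_Cintegral; apply: tameM; [exact: tf|exact: tame_cst].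
rewrite /M_integral.
pose h (y : R) := J (asin y).
have ch y : y \in `]0, 1[ -> {for y, continuous (h : R -> C^o)}.
  rewrite in_itv/= => /andP[y0 y1]; apply: (@continuous_comp R R C^o); last exact: cJ.
  by apply: continuous_asin; apply/andP; split; lra.
(* At y = 0 and y = 1 the segment is a point and the density formula yields 0 instead of a Dirac
   mass, so the integrands are compared on the open interval only. *)
rewrite (@eq_Cintegral_oo _ _ _ h ch); last first.
  move=> y; rewrite in_itv/= => /andP[y0 y1]; rewrite /h /J.
  have y11 : -1 <= y <= 1 by apply/andP; split; lra.
  have sy : sin (asin y) = y by rewrite asinK// in_itv.
  have cy : cos (asin y) = Num.sqrt (1 - y ^+ 2) by rewrite cos_asin.
  have y2 : 0 < 1 - y ^+ 2 by rewrite subr_gt0 expr_lt1// ltW.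
  have -> : - w * (1 - (y%:C)%C ^+ 2) * (y%:C)%C ^+ 2 =
      (((y * Num.sqrt (1 - y ^+ 2)) ^+ 2)%:C)%C * - w.
    rewrite exprMn sqr_sqrtr ?ltW// rmorphM rmorphB rmorph1 rmorphXn/=; ring.
  rewrite sqrtc_scale; last by rewrite mulr_ge0 ?sqrtr_ge0 ?ltW.
  rewrite -/k arcsine_integralE.
  - apply: eq_Cintegral => x _; congr (f _ * _).
    by rewrite /ell sy cy rmorphM; ring.
  - by rewrite mulf_neq0// fmorph_eq0 mulf_neq0 ?gt_eqF// sqrtr_gt0.
  - rewrite (_ : (fun _ => _) = (fun x => f (ell a v k (asin y) x))); first exact: c1.
    apply/funext => x; congr (f _).
    by rewrite /ell sy cy rmorphM; ring.
have -> : (`[0, 1] : interval R) = `[sin 0, sin (pi / 2)] by rewrite sin0 sin_pihalf.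
have pi2 : 0 < pi / 2 :> R by rewrite divr_gt0 ?pi_gt0.
have pi4 : - (pi / 2) < 0 :> R by rewrite oppr_lt0.
rewrite (@Cintegral_subst sin cos _ _ h (fun t => J t * ((cos t)%:C)%C)).
- apply: eq_Cintegral => t _; rewrite /J.
  rewrite mulrC -CintegralZ; last first.
    by move=> x; apply: (@cvgM C); [exact: c1|exact: cvg_cst].
  by apply: eq_Cintegral => x _; rewrite rmorphM/=; ring.
- exact: pi2.
- move=> x y; rewrite !in_itv/= => /andP[x0 x1] /andP[y0 y1].
  by rewrite ltr_sin// in_itv/= ?x1 ?y1 andbT (le_trans (ltW pi4)).
- exact: continuous_cos.
- move=> x; rewrite in_itv/= => /andP[x0 x1]; apply: cos_gt0_pihalf.
  by rewrite x1 (lt_trans pi4).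
- by rewrite sin0 sin_pihalf; exact: ch.
- move=> x; apply: (@cvgM C); first exact: cJ.
  by apply: continuous_of_real; exact: continuous_cos.
- move=> x; rewrite in_itv/= => /andP[x0 x1]; rewrite /h sinK//.
  by rewrite in_itv/= (ltW x1) (le_trans (ltW pi4))// ltW.
Qed.

End Parametrization.

(** * The parametrized points lie in the closed elliptic domain *)

Section Ellipse.
Local Open Scope ring_scope.
Variable R : realType.
Local Notation C := R[i].
Local Notation normc := Normc.normc.

Lemma sqr_normcE (z : C) : normc z ^+ 2 = complex.Re z ^+ 2 + complex.Im z ^+ 2.
Proof. by case: z => x y; rewrite /= sqr_sqrtr// addr_ge0// sqr_ge0. Qed.

(** With foci p^2 and q^2 and the origin on the ellipse, the two differences are the squares of q s
    + i p c and p s + i q c. Their moduli are thus sums of real squares, in which the cross terms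
    cancel. *)
Lemma ellipse_boundary (p q : C) (s c : R) : s ^+ 2 + c ^+ 2 = 1 ->
  let e := (p ^+ 2 + q ^+ 2) * (s%:C)%C ^+ 2 +
           2 * (Complex 0 1 * p * q) * (s%:C)%C * (c%:C)%C in
  normc (e - p ^+ 2) + normc (e - q ^+ 2) = normc (p ^+ 2) + normc (q ^+ 2).
Proof.
move=> sc e.
have c2 : c ^+ 2 = 1 - s ^+ 2 by rewrite -sc addrC addKr.
have cc2 : (c%:C)%C ^+ 2 = 1 - (s%:C)%C ^+ 2 :> C.
  by rewrite -!rmorphXn/= c2 rmorphB rmorph1.
have i2 : (Complex 0 1) ^+ 2 = -1 :> C by rewrite sqr_i.
have -> : e - p ^+ 2 = (q * (s%:C)%C + Complex 0 1 * p * (c%:C)%C) ^+ 2.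
  by rewrite /e; ring: cc2 i2.
have -> : e - q ^+ 2 = (p * (s%:C)%C + Complex 0 1 * q * (c%:C)%C) ^+ 2.
  by rewrite /e; ring: cc2 i2.
rewrite !normcX !sqr_normcE; case: p {e} => p1 p2; case: q => q1 q2 /=.
by ring: c2.
Qed.

(** The point is the convex combination of [e (- k)] and [e k] with weights (1 + cos x)/2 and (1 -
    cos x)/2. Both ends are on the ellipse, and the sum of the distances to the foci is convex. *)
Lemma ell_in_ellipse (a b d v k : C) (t x : R) :
  v = - ((b - a) + (d - a)) -> k ^+ 2 = - ((b - a) * (d - a)) ->
  closed_ellipse_dom b d a (ell a v k t x).
Proof.
move=> vE k2; rewrite /closed_ellipse_dom/=.
pose p := sqrtc (b - a); pose q := sqrtc (d - a).
have p2 : p ^+ 2 = b - a by rewrite sqr_sqrtc.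
have q2 : q ^+ 2 = d - a by rewrite sqr_sqrtc.
have i2 : (Complex 0 1) ^+ 2 = -1 :> C by rewrite sqr_i.
set s := sin t; set c := cos t; set m := cos x.
have /andP[mlo mhi] : -1 <= m <= 1 by rewrite -ler_norml cos_max.
have m1 : 0 <= (1 + m) / 2 by rewrite divr_ge0//; lra.
have m2 : 0 <= (1 - m) / 2 by rewrite divr_ge0//; lra.
pose e (k : C) := a - v * (s%:C)%C ^+ 2 + 2 * k * (s%:C)%C * (c%:C)%C.
have bd (k' : C) : k' ^+ 2 = - ((b - a) * (d - a)) ->
    normc (e k' - b) + normc (e k' - d) = normc (a - b) + normc (a - d).
  move=> k'2.
  (* [k'] and i p q have the same square; a possible sign is absorbed into the choice of root of
     [d - a]. *)
  have [q' q'2 k'E] : exists2 q', q' ^+ 2 = d - a & k' = Complex 0 1 * p * q'.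
    have : k' ^+ 2 == (Complex 0 1 * p * q) ^+ 2.
      by rewrite k'2 !exprMn i2 p2 q2 mulN1r mulNr.
    rewrite eqf_sqr => /orP[/eqP ->|/eqP ->]; first by exists q.
    by exists (- q); rewrite ?sqrrN// mulrN.
  have sc : s ^+ 2 + c ^+ 2 = 1 by rewrite addrC cos2Dsin2.
  have := ellipse_boundary p q' sc => /=.
  rewrite -!k'E p2 q'2 -(normcN (a - b))  -(normcN (a - d)) !opprB => <-.
  by congr (normc _ + normc _); rewrite /e vE; ring.
have sp f : normc (ell a v k t x - f) <=
    (1 + m) / 2 * normc (e (- k) - f) + (1 - m) / 2 * normc (e k - f).
  rewrite -[X in X * _ + _]ger0_norm// -[X in _ <= _ + X * _]ger0_norm//.
  rewrite -!normc_real -!Normc.normcM.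
  apply: le_trans (le_normcD _ _).
  rewrite (_ : ell a v k t x - f = ((1 + m) / 2)%:C%C * (e (- k) - f) +
    ((1 - m) / 2)%:C%C * (e k - f))//.
  rewrite !rmorphM rmorphB rmorphD rmorph1 fmorphV rmorph_nat /ell /e -/s -/c -/m.
  by field.
have kN2 : (- k) ^+ 2 = - ((b - a) * (d - a)) by rewrite sqrrN.
apply: le_trans (lerD (sp b) (sp d)) _.
rewrite addrACA -!mulrDr (bd _ kN2) (bd _ k2) -mulrDl.
by rewrite (_ : (1 + m) / 2 + (1 - m) / 2 = 1) ?mul1r//; field.
Qed.

(** Going from y to z changes each of the two focal distances by at most |z - y|, hence the half.
    The bound does not depend on y. *)
Lemma ellipse_gap (b d a z y : C) : closed_ellipse_dom b d a y ->
  (normc (z - b) + normc (z - d) - (normc (a - b) + normc (a - d))) / 2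
    <= normc (z - y).
Proof.
rewrite /closed_ellipse_dom/= => hy.
have h1 : normc (z - b) <= normc (z - y) + normc (y - b).
  by apply: le_trans (le_normcD _ _); rewrite addrA subrK.
have h2 : normc (z - d) <= normc (z - y) + normc (y - d).
  by apply: le_trans (le_normcD _ _); rewrite addrA subrK.
lra.
Qed.

End Ellipse.

(** * Iterated integrals and the divergence identity *)

Section DoubleIntegral.
Local Open Scope ring_scope.
Variable R : realType.
Local Notation C := R[i].

Lemma tame_sin_fst : tame (fun t _ : R => ((sin t)%:C)%C).
Proof. by apply: (@tame_fst _ _ 1); [exact: continuous_sin|exact: sin_max]. Qed.

Lemma tame_cos_fst : tame (fun t _ : R => ((cos t)%:C)%C).
Proof. by apply: (@tame_fst _ _ 1); [exact: continuous_cos|exact: cos_max]. Qed.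

Lemma tame_sin_snd : tame (fun _ x : R => ((sin x)%:C)%C).
Proof. by apply: (@tame_snd _ _ 1); [exact: continuous_sin|exact: sin_max]. Qed.

Lemma tame_cos_snd : tame (fun _ x : R => ((cos x)%:C)%C).
Proof. by apply: (@tame_snd _ _ 1); [exact: continuous_cos|exact: cos_max]. Qed.

Lemma cderive_sin : cderive (fun t : R => ((sin t)%:C)%C) (fun t => ((cos t)%:C)%C).
Proof. by apply: cderive_real => x; exact: is_derive_sin. Qed.

Lemma cderive_cos : cderive (fun t : R => ((cos t)%:C)%C) (fun t => - ((sin t)%:C)%C).
Proof.
have h : cderive (fun t : R => ((cos t)%:C)%C) (fun t => ((- sin t)%:C)%C).
  by apply: cderive_real => x; exact: is_derive_cos.
by apply: cderive_eq h => x; rewrite rmorphN.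
Qed.

Definition dint (g : R -> R -> C) : C :=
  Cintegral `[0, pi / 2] (fun t => Cintegral `[0, pi] (g t)).

Lemma dintD (f g : R -> R -> C) : tame f -> tame g ->
  dint (fun t x => f t x + g t x) = dint f + dint g.
Proof.
move=> tf tg; rewrite /dint -CintegralD; try exact: ccontinuous_tame_Cintegral.
apply: eq_Cintegral => t _; case: tf => f1 _ _; case: tg => g1 _ _.
by rewrite CintegralD.
Qed.

Lemma dintZ (z : C) (g : R -> R -> C) : tame g ->
  dint (fun t x => z * g t x) = z * dint g.
Proof.
move=> tg; rewrite /dint -CintegralZ; last exact: ccontinuous_tame_Cintegral.
by apply: eq_Cintegral => t _; case: tg => g1 _ _; rewrite CintegralZ.
Qed.

Lemma normc_dint_le (g : R -> R -> C) (M : R) : tame g ->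
  (forall t x, Normc.normc (g t x) <= M) ->
  Normc.normc (dint g) <= 2 * (pi / 2) * (2 * pi * M).
Proof.
move=> tg gM; have pi2 : 0 <= pi / 2 :> R by rewrite divr_ge0// pi_ge0.
rewrite -[X in 2 * X * (_ * _)]subr0 -[X in _ * (2 * X * _)]subr0.
apply: normc_Cintegral_le => //; first exact: ccontinuous_tame_Cintegral.
move=> t; apply: normc_Cintegral_le; first exact: pi_ge0.
- by case: tg.
- exact: gM.
Qed.

Lemma eq_dint (f g : R -> R -> C) : (forall t x, f t x = g t x) -> dint f = dint g.
Proof. by move=> fg; congr dint; apply/funext => t; apply/funext => x. Qed.

(** No exchange of integrals is needed: the t-derivative is pulled out of the inner integral and
    integrated outside, the x-derivative is integrated inside. *)
Lemma dint_divergence (A dA B dB : R -> R -> C) :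
  tame A -> tame dA -> tame dB ->
  (forall x, cderive (A^~ x) (dA^~ x)) ->
  (forall t, cderive (B t) (dB t)) ->
  dint (fun t x => dA t x + dB t x) =
    Cintegral `[0, pi] (A (pi / 2)) - Cintegral `[0, pi] (A 0) +
    Cintegral `[0, pi / 2] (fun t => B t pi - B t 0).
Proof.
move=> tA tdA tdB hA hB; rewrite dintD//; congr (_ + _).
  apply: (@Cintegral_cderive _ _ _ (fun t => Cintegral `[0, pi] (A t))).
  - by rewrite divr_gt0 ?pi_gt0.
  - exact: cderive_Cintegral.
  - exact: ccontinuous_tame_Cintegral.
apply: eq_Cintegral => t _; apply: Cintegral_cderive; first exact: pi_gt0.
- exact: hB.
- by case: tdB.
Qed.

Lemma Cintegral0 (a b : R) : a < b -> Cintegral `[a, b] (fun _ => 0 : C) = 0.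
Proof.
move=> ab; rewrite (@Cintegral_cderive _ a b (fun _ => 0 : C))//.
- by rewrite subrr.
- exact: cderive_cst.
- by move=> x; exact: cvg_cst.
Qed.

Lemma Cintegral_cos_pi (z : C) :
  Cintegral `[0, pi] (fun x => z * ((cos x)%:C)%C) = 0.
Proof.
rewrite (@Cintegral_cderive _ 0 pi (fun x => z * ((sin x)%:C)%C)).
- by rewrite sin0 sinpi subrr.
- exact: pi_gt0.
- by apply: cderive_eq (cderiveM (cderive_cst z) cderive_sin) => x; rewrite mul0r add0r.
- by have [h _ _] := tameM (tame_cst z) tame_cos_snd; exact: (h 0).
Qed.

Lemma dint_weight : dint (fun t _ => ((cos t / pi)%:C)%C) = 1.
Proof.
have inner t : Cintegral `[0, pi] (fun _ : R => ((cos t / pi)%:C)%C) = ((cos t)%:C)%C.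
  rewrite (@Cintegral_cderive _ 0 pi (fun x => ((cos t / pi)%:C)%C * (x%:C)%C)).
  - rewrite mulr0 subr0 -rmorphM/= divfK//.
    by rewrite gt_eqF// pi_gt0.
  - exact: pi_gt0.
  - have hid : cderive (fun x : R => (x%:C)%C) (fun _ => (1%:C)%C).
      by apply: cderive_real => x; exact: is_derive_id.
    by apply: cderive_eq (cderiveM (cderive_cst _) hid) => x; rewrite mul0r add0r mulr1.
  - by move=> x; exact: cvg_cst.
rewrite /dint (funext inner) (@Cintegral_cderive _ 0 (pi / 2) (fun x => ((sin x)%:C)%C)).
- by rewrite sin_pihalf sin0 subr0.
- by rewrite divr_gt0 ?pi_gt0.
- exact: cderive_sin.
- by have [h _ _] := tame_cos_snd; exact: (h 0).
Qed.

(** Here s, c are sine and cosine of t, p, q those of x, and [At], [Bp] are derivatives already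
    expanded by the rule that y has partial derivatives [Xt * y ^+ 2] and [Xp * y ^+ 2]. So y may be
    a free symbol, and the circle relations suffice. The coefficient of y says that the spherical
    Laplacian of X is [- Q2]. *)
Lemma sphere_flux_identity (K : comNzRingType) (s c p q v k y : K) :
  c ^+ 2 = 1 - s ^+ 2 -> q ^+ 2 = 1 - p ^+ 2 ->
  let X := - v * s ^+ 2 - 2 * (k * s * c) * q in
  let Xt := - 2 * v * s * c - 2 * k * (c ^+ 2 - s ^+ 2) * q in
  let Xtt := - 2 * v * (c ^+ 2 - s ^+ 2) + 8 * k * s * c * q in
  let Xp := 2 * k * s * c * p in
  let q2t := - 2 * k ^+ 2 * s * c * q ^+ 2 + 2 * v * k * q * (c ^+ 2 - s ^+ 2)
    + 2 * (k ^+ 2 + v ^+ 2) * s * c in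
  let q2tt := - 2 * k ^+ 2 * (c ^+ 2 - s ^+ 2) * q ^+ 2 - 8 * v * k * q * s * c
    + 2 * (k ^+ 2 + v ^+ 2) * (c ^+ 2 - s ^+ 2) in
  let Q0 := X ^+ 3 + v * X ^+ 2 - k ^+ 2 * X in
  let Q1 := 3 * X ^+ 2 + 2 * v * X - k ^+ 2 in
  let Q2 := 6 * X + 2 * v in
  let At := - s * (- Xt * y - 2 * (q2t + (v + X) * Xt) * y ^+ 2)
    + c * (- Xtt * y - Xt * (Xt * y ^+ 2)
      - 2 * (q2tt + Xt * Xt + (v + X) * Xtt) * y ^+ 2
      - 2 * (q2t + (v + X) * Xt) * (2 * y * (Xt * y ^+ 2))) in
  let Bp := - 2 * k * s * (q * y + p * (Xp * y ^+ 2))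
    + 4 * (q * ((k ^+ 2 * c * q - X * k * s) * y ^+ 2)
      + p * ((- k ^+ 2 * c * p - Xp * k * s) * y ^+ 2
        + (k ^+ 2 * c * q - X * k * s) * (2 * y * (Xp * y ^+ 2)))) in
  8 * c * (2 * Q0 * y ^+ 3 + Q1 * y ^+ 2) + c * Q2 * y = At + Bp.
Proof.
move=> c2 q2 X Xt Xtt Xp q2t q2tt Q0 Q1 Q2 At Bp.
rewrite /At /Bp /Q0 /Q1 /Q2 /q2t /q2tt /Xp /Xtt /Xt /X.
by ring: c2 q2.
Qed.

End DoubleIntegral.

Ltac tame_tac :=
  lazymatch goal with
  | |- tame (fun _ _ => ?z) => exact: (tame_cst z)
  | |- tame (fun t x => @?f t x + @?g t x) => apply: (@tameD _ f g); tame_tac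
  | |- tame (fun t x => - @?f t x) => apply: (@tameN _ f); tame_tac
  | |- tame (fun t x => @?f t x * @?g t x) => apply: (@tameM _ f g); tame_tac
  | |- tame (fun t x => @?f t x ^+ ?n) => apply: (@tameX _ f n); tame_tac
  | |- tame (fun t _ => ((sin t)%:C)%C) => exact: tame_sin_fst
  | |- tame (fun t _ => ((cos t)%:C)%C) => exact: tame_cos_fst
  | |- tame (fun _ x => ((sin x)%:C)%C) => exact: tame_sin_snd
  | |- tame (fun _ x => ((cos x)%:C)%C) => exact: tame_cos_snd
  | H : tame ?f |- tame (fun t x => ?f t x) => exact: H
  | H : tame ?f |- tame ?f => exact: H
  end.

(** The derivative stays an existential variable that the differentiation rules fill in; after
    [cderive_eq], [ring] compares it with the intended formula. *)
Ltac cderive_tac :=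
  lazymatch goal with
  | |- cderive (fun _ => ?z) _ => exact: (cderive_cst z)
  | |- cderive (fun t => @?f t + @?g t) _ => eapply (@cderiveD _ f _ g _); cderive_tac
  | |- cderive (fun t => - @?f t) _ => eapply (@cderiveN _ f _); cderive_tac
  | |- cderive (fun t => @?f t * @?g t) _ => eapply (@cderiveM _ f _ g _); cderive_tac
  | |- cderive (fun t => @?f t ^+ 2) _ => eapply (@cderiveX2 _ f _); cderive_tac
  | |- cderive (fun t => ((sin t)%:C)%C) _ => exact: cderive_sin
  | |- cderive (fun t => ((cos t)%:C)%C) _ => exact: cderive_cos
  | H : cderive ?f _ |- cderive ?f _ => exact: H
  end.

(** * Vanishing flux through the boundary of the quarter sphere *)

Section Flux.
Local Open Scope ring_scope.
Variable R : realType.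
Local Notation C := R[i].
Variables (a v k z : C) (d : R).
Hypothesis d0 : 0 < d.
Hypothesis zd : forall t x : R, d <= Normc.normc (z - ell a v k t x).

Let s (t : R) : C := ((sin t)%:C)%C.
Let c (t : R) : C := ((cos t)%:C)%C.
Let y (t x : R) : C := (z - ell a v k t x)^-1.
Let X (t x : R) : C := - v * s t ^+ 2 - 2 * (k * s t * c t) * c x.
Let Xt (t x : R) : C := - 2 * v * s t * c t - 2 * k * (c t ^+ 2 - s t ^+ 2) * c x.
Let Xtt (t x : R) : C := - 2 * v * (c t ^+ 2 - s t ^+ 2) + 8 * k * s t * c t * c x.
Let Xx (t x : R) : C := 2 * k * s t * c t * s x.
(* Let n be the point of the sphere with latitude t and longitude x, so that
   X = <S n, n> for S = ((0, 0, -k), (0, 0, 0), (-k, 0, -v)). Then qt is the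
   t-derivative of |S n|^2, and A, B are 8 times the components (weighted by
   the area element) of the tangent field
   - (1/2) f'(X) ((S^2 - |S n|^2) n + (v + X) (S - X) n) - (1/4) f(X) (S - X) n
   where f(X) = 1 / (z - a - X). *)
Let qt (t x : R) : C := - 2 * k ^+ 2 * s t * c t * c x ^+ 2
  + 2 * v * k * c x * (c t ^+ 2 - s t ^+ 2) + 2 * (k ^+ 2 + v ^+ 2) * s t * c t.
Let qtt (t x : R) : C := - 2 * k ^+ 2 * (c t ^+ 2 - s t ^+ 2) * c x ^+ 2
  - 8 * v * k * c x * s t * c t + 2 * (k ^+ 2 + v ^+ 2) * (c t ^+ 2 - s t ^+ 2).
Let A (t x : R) : C :=
  c t * (- Xt t x * y t x - 2 * (qt t x + (v + X t x) * Xt t x) * y t x ^+ 2).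
Let B (t x : R) : C := - 2 * k * s t * (s x * y t x)
  + 4 * (s x * ((k ^+ 2 * c t * c x - X t x * k * s t) * y t x ^+ 2)).
Let At (t x : R) : C :=
  - s t * (- Xt t x * y t x - 2 * (qt t x + (v + X t x) * Xt t x) * y t x ^+ 2)
  + c t * (- Xtt t x * y t x - Xt t x * (Xt t x * y t x ^+ 2)
    - 2 * (qtt t x + Xt t x * Xt t x + (v + X t x) * Xtt t x) * y t x ^+ 2
    - 2 * (qt t x + (v + X t x) * Xt t x) * (2 * y t x * (Xt t x * y t x ^+ 2))).
Let Bx (t x : R) : C :=
  - 2 * k * s t * (c x * y t x + s x * (Xx t x * y t x ^+ 2))
  + 4 * (c x * ((k ^+ 2 * c t * c x - X t x * k * s t) * y t x ^+ 2)
    + s x * ((- k ^+ 2 * c t * s x - Xx t x * k * s t) * y t x ^+ 2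
      + (k ^+ 2 * c t * c x - X t x * k * s t) * (2 * y t x * (Xx t x * y t x ^+ 2)))).

Lemma tame_ell : tame (ell a v k).
Proof. by rewrite /ell; tame_tac. Qed.

Lemma tame_resolvent : tame (fun t x => (z - ell a v k t x)^-1).
Proof.
apply: (tameV d0 zd); apply: tameD; first exact: tame_cst.
by apply: tameN; exact: tame_ell.
Qed.

Let u_neq0 t x : z - ell a v k t x != 0.
Proof.
by apply/eqP => h; have := zd t x; rewrite h Normc.normc0 leNgt d0.
Qed.

Let ty : tame y. Proof. exact: tame_resolvent. Qed.
Let tX : tame X. Proof. by rewrite /X /s /c; tame_tac. Qed.
Let tXt : tame Xt. Proof. by rewrite /Xt /s /c; tame_tac. Qed.
Let tXtt : tame Xtt. Proof. by rewrite /Xtt /s /c; tame_tac. Qed.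
Let tXx : tame Xx. Proof. by rewrite /Xx /s /c; tame_tac. Qed.
Let tqt : tame qt. Proof. by rewrite /qt /s /c; tame_tac. Qed.
Let tqtt : tame qtt. Proof. by rewrite /qtt /s /c; tame_tac. Qed.

Let ellE t x : ell a v k t x = a + X t x.
Proof. by rewrite /ell /X -/(s t) -/(c t) -/(c x); ring. Qed.

Let dX x : cderive (X^~ x) (Xt^~ x).
Proof.
apply: cderive_eq; last by rewrite /X /s /c; cderive_tac.
by move=> t; rewrite /Xt /s /c; ring.
Qed.

Let dXt x : cderive (Xt^~ x) (Xtt^~ x).
Proof.
apply: cderive_eq; last by rewrite /Xt /s /c; cderive_tac.
by move=> t; rewrite /Xtt /s /c; ring.
Qed.

Let dqt x : cderive (qt^~ x) (qtt^~ x).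
Proof.
apply: cderive_eq; last by rewrite /qt /s /c; cderive_tac.
by move=> t; rewrite /qtt /s /c; ring.
Qed.

Let dy x : cderive (y^~ x) (fun t => Xt t x * y t x ^+ 2).
Proof.
have h : cderive (fun t => z - ell a v k t x) (fun t => - Xt t x).
  have := cderiveD (cderive_cst (z - a)) (cderiveN (dX x)).
  move=> /cderive_eq h; apply: cderive_ext (h _ _); last by move=> t; rewrite add0r.
  by move=> t; rewrite ellE; ring.
have := cderiveV (u_neq0 ^~ x) h.
by apply: cderive_eq => t; rewrite opprK.
Qed.

Let dXx t : cderive (X t) (Xx t).
Proof.
apply: cderive_eq; last by rewrite /X /s /c; cderive_tac.
by move=> x; rewrite /Xx /s /c; ring.
Qed.

Let dyx t : cderive (y t) (fun x => Xx t x * y t x ^+ 2).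
Proof.
have h : cderive (fun x => z - ell a v k t x) (fun x => - Xx t x).
  have := cderiveD (cderive_cst (z - a)) (cderiveN (dXx t)).
  move=> /cderive_eq h; apply: cderive_ext (h _ _); last by move=> x; rewrite add0r.
  by move=> x; rewrite ellE; ring.
have := cderiveV (u_neq0 t) h.
by apply: cderive_eq => x; rewrite opprK.
Qed.

Let dA x : cderive (A^~ x) (At^~ x).
Proof.
have h1 := dX x; have h2 := dXt x; have h3 := dqt x; have h4 := dy x.
apply: cderive_eq; last by rewrite /A /c; cderive_tac.
by move=> t; rewrite /At /s /c; ring.
Qed.

Let dB t : cderive (B t) (Bx t).
Proof.
have h1 : cderive (fun x => X t x) (Xx t) := dXx t.
have h4 : cderive (fun x => y t x) _ := dyx t.
apply: cderive_eq; last by rewrite /B /s /c; cderive_tac.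
by move=> x; rewrite /Bx /s /c; ring.
Qed.

Lemma flux_zero :
  dint (fun t x => let X := ell a v k t x - a in let y := (z - ell a v k t x)^-1 in
    8 * c t * (2 * (X ^+ 3 + v * X ^+ 2 - k ^+ 2 * X) * y ^+ 3 +
    (3 * X ^+ 2 + 2 * v * X - k ^+ 2) * y ^+ 2) + c t * (6 * X + 2 * v) * y) = 0.
Proof.
have sc t : c t ^+ 2 = 1 - s t ^+ 2.
  rewrite /c /s -!rmorphXn/= -(rmorph1 (real_complex R)) -rmorphB.
  by congr ((_)%:C)%C; rewrite -(cos2Dsin2 t) addrK.
rewrite (@eq_dint _ _ (fun t x => At t x + Bx t x)); last first.
  move=> t x /=; have -> : ell a v k t x - a = X t x by rewrite ellE addrAC subrr add0r.
  exact: (sphere_flux_identity v k (y t x) (sc t) (sc x)).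
rewrite (@dint_divergence _ A At B Bx) //; last 3 first.
- by rewrite /A /c; tame_tac.
- by rewrite /At /s /c; tame_tac.
- by rewrite /Bx /s /c; tame_tac.
(* At the pole the circle of latitude has length 0. *)
have -> : A (pi / 2) = fun _ => 0.
  by apply/funext => x; rewrite /A /c cos_pihalf mul0r.
(* On the equator X = 0 and qt + v Xt = 0, so the terms in y^2 drop out; the rest is odd under x ->
   pi - x. *)
have -> : A 0 = fun x => (2 * k * (z - a)^-1) * ((cos x)%:C)%C.
  apply/funext => x; rewrite /A /qt /Xt /y ellE /X /s /c sin0 cos0 rmorph0 rmorph1.
  have -> : z - (a + (- v * 0 ^+ 2 - 2 * (k * 0 * 1) * ((cos x)%:C)%C)) = z - a by ring.
  by ring.
rewrite Cintegral_cos_pi Cintegral0 ?pi_gt0// subrr add0r.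
(* The meridians x = 0 and x = pi lie in the plane of symmetry of S, to which the field is
   tangent. *)
have -> : (fun t => B t pi - B t 0) = fun _ => 0.
  by apply/funext => t; rewrite /B /s sinpi sin0 rmorph0; ring.
by rewrite Cintegral0// divr_gt0 ?pi_gt0.
Qed.

End Flux.

(** * Resolvent moments and their derivatives in z *)

Section Moments.
Local Open Scope ring_scope.
Variable R : realType.
Local Notation C := R[i].
Local Notation normc := Normc.normc.

(** The difference quotient misses [dG] by h E, of modulus at most K |h|. *)
Lemma is_derive_quadratic (G : C^o -> C^o) (z dG : C) (K r : R) : 0 < r ->
  (forall h, normc h < r ->
    exists2 E, G (h + z) = G z + h * dG + h ^+ 2 * E & normc E <= K) ->
  is_derive (z : C^o) 1 G dG.
Proof.
move=> r0 hG.
have K0 : 0 <= K.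
  have [|E _ EK] := hG 0; first by rewrite Normc.normc0.
  exact: le_trans (normc_ge0 E) EK.
suff lim : h^-1 *: (G (h *: 1 + z) - G z) @[h --> (0 : C^o)^'] --> (dG : C^o).
  by apply: DeriveDef; [apply/cvg_ex; exists dG|exact: cvg_lim].
apply/(@cvgrPdist_lt _ C^o C^o _ (dnbhs_filter _)) => e /pos_complexR[e' e0 ->].
have K1 : 0 < K + 1 by rewrite ltr_wpDl.
(* [K + 1] serves as a positive bound, since K may be 0. *)
apply/nbhs_ballP; exists ((Num.min r (e' / (K + 1)))%:C)%C => /=.
  by rewrite ltcR lt_min r0 divr_gt0.
move=> h; rewrite -ball_normE/= sub0r normrN lt_normcR lt_min => /andP[hr he] h0.
have [E GE EK] := hG h hr.
have -> : h *: 1 + z = h + z by rewrite /GRing.scale/= mulr1.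
rewrite GE /GRing.scale/=.
have -> : dG - h^-1 * (G z + h * dG + h ^+ 2 * E - G z) = - (h * E).
  by field.
rewrite lt_normcR normcN Normc.normcM.
apply: (@le_lt_trans _ _ (normc h * (K + 1))).
  by rewrite ler_pM2l ?(le_trans EK) ?lerDl// lt0r normc_ge0 andbT;
    apply: contra h0 => /eqP /Normc.eq0_normc ->.
by rewrite -ltr_pdivlMr.
Qed.

Variables (a v k : C).

Definition separated (z : C) (d : R) :=
  0 < d /\ forall t x, d <= normc (z - ell a v k t x).

(** For z separated from the points, n = 1 gives the Cauchy transform; its first two derivatives are
    [- moment 2] and [2 * moment 3]. *)
Definition moment (n : nat) (z : C) : C :=
  dint (fun t x => ((cos t / pi)%:C)%C * (z - ell a v k t x)^-1 ^+ n).

Lemma tame_weight : tame (fun t _ : R => ((cos t / pi)%:C)%C).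
Proof.
rewrite (_ : (fun _ => _) = fun t (_ : R) => ((cos t)%:C)%C * ((pi^-1)%:C)%C).
  by tame_tac.
by apply/funext => t; apply/funext => x; rewrite rmorphM.
Qed.

Lemma separatedD (z h : C) (d : R) : separated z d -> normc h < d / 2 ->
  separated (h + z) (d / 2).
Proof.
move=> [d0 zd] hd; split; first by rewrite divr_gt0.
move=> t x; have := zd t x.
have : normc (z - ell a v k t x) <= normc (h + z - ell a v k t x) + normc (- h).
  by apply: le_trans (le_normcD _ _); rewrite (_ : _ + - h = z - ell a v k t x)//; ring.
rewrite normcN; lra.
Qed.

Lemma tame_sep (z : C) (d : R) : separated z d -> tame (fun t x => (z - ell a v k t x)^-1).
Proof. by move=> [d0 zd]; exact: tame_resolvent d0 zd. Qed.

Lemma sep_neq0 (z : C) (d : R) t x : separated z d -> z - ell a v k t x != 0.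
Proof.
by move=> [d0 zd]; apply/eqP => h; have := zd t x; rewrite h Normc.normc0 leNgt d0.
Qed.

Lemma normc_resolvent_le (z : C) (d : R) t x : separated z d ->
  normc (z - ell a v k t x)^-1 <= d^-1.
Proof.
move=> [d0 zd]; rewrite Normc.normcV lef_pV2// posrE//.
exact: lt_le_trans (zd t x).
Qed.

Lemma normc_resolventX_le n (z : C) (d : R) t x : separated z d ->
  normc ((z - ell a v k t x)^-1 ^+ n) <= d^-1 ^+ n.
Proof.
move=> sz; rewrite normcX; case: n => [|n]; first by rewrite !expr0.
by rewrite lerXn2r ?nnegrE ?normc_ge0 ?invr_ge0 ?(ltW sz.1)// normc_resolvent_le.
Qed.

(** Integrate 1/(u + h) = 1/u - h/u^2 + h^2/(u^2 (u + h)), where |u| >= d and |u + h| >= d/2. *)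
Lemma moment1_taylor (z : C) (d : R) : separated z d -> exists K, forall h, normc h < d / 2 ->
  exists2 E, moment 1 (h + z) = moment 1 z + h * (- moment 2 z) + h ^+ 2 * E & normc E <= K.
Proof.
move=> sz; have tW := tame_weight; have [_ _ [M WM]] := tame_weight.
exists (2 * (pi / 2) * (2 * pi * (M * (d^-1 ^+ 2 * (d / 2)^-1)))) => h hd.
have sh := separatedD sz hd; have t1 := tame_sep sz; have t2 := tame_sep sh.
exists (dint (fun t x => ((cos t / pi)%:C)%C *
  ((z - ell a v k t x)^-1 ^+ 2 * (h + z - ell a v k t x)^-1))); last first.
  apply: normc_dint_le; first by tame_tac.
  move=> t x; rewrite Normc.normcM [normc (_ ^+ 2 * _)]Normc.normcM.
  rewrite ler_pM ?mulr_ge0 ?normc_ge0 ?(WM t x)//.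
  by rewrite ler_pM ?normc_ge0 ?normc_resolventX_le ?normc_resolvent_le.
rewrite /moment mulrN -mulNr -!dintZ; try by tame_tac.
rewrite -!dintD; try by tame_tac.
apply: eq_dint => t x.
have u0 := sep_neq0 t x sz; have u1 := sep_neq0 t x sh.
move: u0 u1 (((cos t / pi)%:C)%C) => + + W.
rewrite -addrA; set u := z - _; move: u => u u0 u1.
by field; rewrite u0 u1.
Qed.

Lemma moment2_taylor (z : C) (d : R) : separated z d -> exists K, forall h, normc h < d / 2 ->
  exists2 E, moment 2 (h + z) = moment 2 z + h * (- (2 * moment 3 z)) + h ^+ 2 * E &
    normc E <= K.
Proof.
move=> sz; have tW := tame_weight; have [_ _ [M WM]] := tame_weight.
exists (2 * (pi / 2) * (2 * pi * (M * (2 * (d^-1 ^+ 3 * (d / 2)^-1) +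
   d^-1 ^+ 2 * (d / 2)^-1 ^+ 2)))) => h hd.
have sh := separatedD sz hd; have t1 := tame_sep sz; have t2 := tame_sep sh.
(* The exact remainder of (u + h)^(-2) is h^2 (3u + 2h)/(u^3 (u + h)^2); writing 3u + 2h = 2(u + h)
   + u splits it into these two terms. *)
exists (dint (fun t x => ((cos t / pi)%:C)%C *
  (2 * ((z - ell a v k t x)^-1 ^+ 3 * (h + z - ell a v k t x)^-1) +
   (z - ell a v k t x)^-1 ^+ 2 * (h + z - ell a v k t x)^-1 ^+ 2))); last first.
  apply: normc_dint_le; first by tame_tac.
  move=> t x.
  have b1 n := normc_resolventX_le n t x sz.
  have b2 n := normc_resolventX_le n t x sh.
  have n2 : normc (2 : C) = 2 by rewrite -(rmorph_nat (real_complex R)) normc_real ger0_norm.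
  rewrite Normc.normcM ler_pM ?normc_ge0 ?(WM t x)//.
  apply: (le_trans (le_normcD _ _)); rewrite [normc (2 * _)]Normc.normcM n2.
  rewrite [normc (_ ^+ 3 * _)]Normc.normcM [normc (_ ^+ 2 * _ ^+ 2)]Normc.normcM lerD//.
    by rewrite ler_pM2l// ler_pM ?normc_ge0 ?(b1 3%N) ?(b2 1%N).
  by rewrite ler_pM ?normc_ge0 ?(b1 2%N) ?(b2 2%N).
rewrite /moment mulrN mulrA -mulNr -!dintZ; try by tame_tac.
rewrite -!dintD; try by tame_tac.
apply: eq_dint => t x.
have u0 := sep_neq0 t x sz; have u1 := sep_neq0 t x sh.
move: u0 u1 (((cos t / pi)%:C)%C) => + + W.
rewrite -addrA; set u := z - _; move: u => u u0 u1.
by field; rewrite u0 u1.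
Qed.

(** Substituting X = (z - a) - u with u y = 1 into the zero-flux identity expands the monic cubic at
    z. Its third derivative 6 is collected with factor - 8/3 + 4 - 1 = 1/3, which gives the constant
    2 because the weight has mass 1. *)
Lemma moment_ode (z : C) (d : R) : separated z d ->
  16 * ((z - a) ^+ 3 + v * (z - a) ^+ 2 - k ^+ 2 * (z - a)) * moment 3 z
  + - 8 * (3 * (z - a) ^+ 2 + 2 * v * (z - a) - k ^+ 2) * moment 2 z
  + (6 * (z - a) + 2 * v) * moment 1 z + 2 = 0.
Proof.
move=> sz; have tW := tame_weight; have t1 := tame_sep sz; have tE := tame_ell a v k.
have := flux_zero sz.1 sz.2 => /(congr1 (fun u => ((pi^-1)%:C)%C * u)).
rewrite mulr0 -dintZ; last by cbv zeta; tame_tac.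
have two : (2 : C) = dint (fun t _ => 2 * ((cos t / pi)%:C)%C).
  by have := dintZ 2 tW; rewrite dint_weight mulr1 => h; exact: (esym h).
move=> <-; rewrite [X in _ + X = _]two /moment.
rewrite -!dintZ; try by tame_tac.
rewrite -!dintD; try by tame_tac.
apply: eq_dint => t x /=.
have u0 := sep_neq0 t x sz.
have -> : ell a v k t x - a = (z - a) - (z - ell a v k t x) by ring.
move: u0; set u := z - ell _ _ _ _ _; move: u => u u0.
have uu : u * u^-1 = 1 by rewrite divff.
move: (u^-1) uu => y uy; rewrite rmorphM/=.
by ring: uy.
Qed.

End Moments.

(** * The differential equation for Q *)

Lemma big_ord3_distinct (S : comNzRingType) (F : 'I_3 -> S) (i j k : 'I_3) :
  i != j -> i != k -> j != k -> (\prod_(l < 3) F l = F i * F j * F k)%R.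
Proof.
move=> ij ik jk; rewrite (bigD1 i)//= (bigD1 j)/= 1?eq_sym//.
rewrite (bigD1 k)/=; last by rewrite eq_sym ik eq_sym jk.
rewrite big_pred0; first by rewrite mulr1 mulrA.
move: i j k ij ik jk => [[|[|[|//]]] ?] [[|[|[|//]]] ?] [[|[|[|//]]] ?] // _ _ _.
all: by move=> [[|[|[|//]]] ?].
Qed.

Theorem theorem1p6 (R : realType) (a : 'I_3 -> R[i]) (c : R[i])
    (i j k : 'I_3) (v w : R[i]) :
  injective a -> c != 0 ->
  i != j -> i != k -> j != k ->
  let Q : {poly R[i]} := c *: \prod_(l < 3) ('X - (a l)%:P) in
  (forall z : R[i],
      Q.[z] = c * ((z - a i) ^+ 3 + v * (z - a i) ^+ 2 + w * (z - a i))) ->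
  let CQ : (R[i])^o -> (R[i])^o := cauchy_M (a i) v w in
  forall z : R[i], ~ closed_ellipse_dom (a j) (a k) (a i) z ->
    derivable CQ z 1 /\ derivable (derive1 CQ) z 1 /\
    Q.[z] * derive1n 2 CQ z + (deriv Q).[z] * derive1 CQ z
      + (derivn 2 Q).[z] / 8 * CQ z + (derivn 3 Q).[z] / 24 = 0.
Proof.
move=> inj_a c0 ij ik jk Q QE CQ z zout.
have QP : Q = c *: (('X - (a i)%:P) * ('X - (a j)%:P) * ('X - (a k)%:P)).
  by rewrite /Q (big_ord3_distinct _ ij ik jk).
have aij : a j - a i != 0 by rewrite subr_eq0 (inj_eq inj_a) eq_sym.
have aik : a k - a i != 0 by rewrite subr_eq0 (inj_eq inj_a) eq_sym.
have ajk : a j - a k != 0 by rewrite subr_eq0 (inj_eq inj_a).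
have quad b : b - a i != 0 -> Q.[b] = 0 -> (b - a i) ^+ 2 + v * (b - a i) + w = 0.
  move=> b0; rewrite QE => /eqP; rewrite mulf_eq0 (negbTE c0)/= => /eqP h.
  by apply: (mulfI b0); rewrite mulr0 -h; ring.
have hj := quad _ aij; have hk := quad _ aik.
have {}hj : (a j - a i) ^+ 2 + v * (a j - a i) + w = 0.
  by apply: hj; rewrite QP hornerZ !hornerM !hornerXsubC; ring.
have {}hk : (a k - a i) ^+ 2 + v * (a k - a i) + w = 0.
  by apply: hk; rewrite QP hornerZ !hornerM !hornerXsubC; ring.
(* Vieta for the quadratic cofactor: the difference of [hj] and [hk] has the nonzero factor
   [a j - a k]. *)
have vE : v = - ((a j - a i) + (a k - a i)).
  apply: (mulfI ajk); apply/eqP; rewrite -subr_eq0; apply/eqP.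
  by rewrite -[RHS](subrr 0) -{1}hj -hk; ring.
have wE : w = (a j - a i) * (a k - a i).
  have -> : w = - ((a j - a i) ^+ 2 + v * (a j - a i)).
    by apply/eqP; rewrite -addr_eq0 addrC hj.
  by rewrite vE; ring.
have w0 : w != 0 by rewrite wE mulf_neq0.
pose s := sqrtc (- w).
have s2 : s ^+ 2 = - w by rewrite sqr_sqrtc.
have CQE z' d : separated (a i) v s z' d -> CQ z' = moment (a i) v s 1 z'.
  by move=> sz; rewrite /CQ /cauchy_M (M_integralE w0)//; exact: tame_sep sz.
clearbody CQ.
have d1 z' d : separated (a i) v s z' d -> is_derive (z' : R[i]^o) 1 CQ (- moment (a i) v s 2 z').
  move=> sz; have [K hK] := moment1_taylor sz.
  apply: (@is_derive_quadratic _ _ _ _ K (d / 2)); first by rewrite divr_gt0// sz.1.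
  move=> h hd; have [E hE EK] := hK h hd.
  exists E; last exact: EK.
  rewrite (CQE _ _ (separatedD sz hd)) (CQE _ _ sz); exact: hE.
have d1E z' d : separated (a i) v s z' d -> derive1 CQ z' = - moment (a i) v s 2 z'.
  by move=> sz; rewrite derive1E; have := d1 _ _ sz => /@derive_val.
have d2 z' d : separated (a i) v s z' d ->
    is_derive (z' : R[i]^o) 1 (derive1 CQ) (2 * moment (a i) v s 3 z').
  move=> sz; have [K hK] := moment2_taylor sz.
  apply: (@is_derive_quadratic _ _ _ _ K (d / 2)); first by rewrite divr_gt0// sz.1.
  move=> h hd; have [E hE EK] := hK h hd.
  exists (- E); last by rewrite normcN.
  rewrite (d1E _ _ (separatedD sz hd)) (d1E _ _ sz) hE.
  by rewrite !opprD mulrN opprK mulrN.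
have [d sz] : exists d, separated (a i) v s z d.
  exists ((Normc.normc (z - a j) + Normc.normc (z - a k) -
    (Normc.normc (a i - a j) + Normc.normc (a i - a k))) / 2); split.
    by rewrite divr_gt0// subr_gt0 ltNge; exact/negP.
  move=> t x; apply: ellipse_gap; apply: ell_in_ellipse => //.
  by rewrite s2 wE.
have [der1 _] := d1 _ _ sz; have [der2 der2E] := d2 _ _ sz.
split; first exact: der1.
split; first exact: der2.
have -> : derive1n 2 CQ z = 2 * moment (a i) v s 3 z by rewrite /derive1n/= derive1E.
rewrite (d1E _ _ sz) (CQE _ _ sz).
have := moment_ode sz; rewrite s2 => ode.
pose P l : {poly R[i]} := 'X - (a l)%:P.
have PE l : (P l).[z] = z - a l by rewrite hornerXsubC.
have dP l : deriv (P l) = 1 by rewrite derivXsubC.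
have {}QP : Q = c *: (P i * P j * P k) by [].
clearbody P.
have Q1p : deriv Q = c *: ((P i + P j) * P k + P i * P j).
  by rewrite QP derivZ !derivM !dP !(mul1r, mulr1) [P j + _]addrC.
have Q2p : deriv (deriv Q) = (2 * c) *: (P i + P j + P k).
  rewrite Q1p derivZ !(derivM, derivD) !dP !(mul1r, mulr1) -mulr2n mulrC.
  by rewrite -!mul_polyC rmorphM rmorph_nat; ring.
have Q3p : deriv (deriv (deriv Q)) = (6 * c)%:P.
  rewrite Q2p derivZ !derivD !dP -mul_polyC !rmorphM !rmorph_nat; ring.
have Q1 : (deriv Q).[z] = c * (3 * (z - a i) ^+ 2 + 2 * v * (z - a i) + w).
  by rewrite Q1p hornerZ !(hornerM, hornerD) !PE vE wE; ring.
have Q2 : (derivn 2 Q).[z] = c * (6 * (z - a i) + 2 * v).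
  by rewrite [derivn 2 Q]Q2p hornerZ !hornerD !PE vE; ring.
have Q3 : (derivn 3 Q).[z] = 6 * c.
  by rewrite [derivn 3 Q]Q3p hornerC.
rewrite QE Q1 Q2 Q3.
move: ode; move: (moment _ _ _ 3 z) (moment _ _ _ 2 z) (moment _ _ _ 1 z) (z - a i).
(* The factor c/8 matches the leading terms 16 m3 and Q C'' = 2 Q m3, and turns the constant 2 into
   c/4 = Q'''/24. *)
by move=> m3 m2 m1 u ode; rewrite -[RHS](mulr0 (c / 8)) -ode; field.
Qed.
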